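(* Let $F=0$ be a generic hyperbolic equation, and let $\epsilon=\pm1$ be the sign occurring in its generic hyperbolic structure equations. Then $\epsilon$ is a contact invariant, and moreover $\epsilon=\mathrm{sgn}(I_1I_2)$.
   Context: All considerations are local and in the smooth category. $J^2(\mathbb{R}^2,\mathbb{R})$ has coordinates $(x,y,z,p,q,r,s,t)$ ($p=z_x,q=z_y,r=z_{xx},s=z_{xy},t=z_{yy}$). For a second order PDE $F(x,y,z,p,q,r,s,t)=0$, a nondegenerate parametrization is a smooth map $i_F:\Sigma_7\to J^2(\mathbb{R}^2,\mathbb{R})$ from an open set $\Sigma_7\subset\mathbb{R}^7$, of maximal rank $7$, whose image is the locus and is everywhere transverse to the fibres of $J^2(\mathbb{R}^2,\mathbb{R})\to J^1(\mathbb{R}^2,\mathbb{R})$. $I_F$ is the Pfaffian system on $\Sigma_7$ generated by the pullbacks $\omega^1,\omega^2,\omega^3$ of $dz-p\,dx-q\,dy$, $dp-r\,dx-s\,dy$, $dq-s\,dx-t\,dy$. Up to scale, define $\langle\varphi,\psi\rangle_7\,\mathrm{Vol}=d\varphi\wedge d\psi\wedge\omega^1\wedge\omega^2\wedge\omega^3$ on $I_F$. The equation is hyperbolic if $i_F^*(F_rF_t-\frac14F_s^2)<0$; then $I_F$ contains exactly two rank-two maximally isotropic subsystems $M_1,M_2$ (labelling chosen). $\mathrm{class}(I)$ is the rank of the annihilator of $\{X: X\in I^\perp,\ X\lrcorner dI\subset I\}$. A hyperbolic equation is generic if $\mathrm{class}(M_1)=\mathrm{class}(M_2)=7$. Contact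 equivalence of $F=0$, $\bar F=0$: a local diffeomorphism $\phi:\Sigma_7\to\bar\Sigma_7$ with $\phi^*I_{\bar F}=I_F$. Every generic hyperbolic equation admits a coframe $\{\omega^i\}_{i=1}^7$ on $\Sigma_7$ with $I_F=\{\omega^1,\omega^2,\omega^3\}$, $I_F^{(1)}=\{\omega^1\}$ (first derived system), $M_1=\{\omega^1,\omega^2\}$, $M_2=\{\omega^1,\omega^3\}$ such that, for some $\epsilon=\pm1$: $d\omega^1\equiv\omega^3\wedge\omega^6+\omega^2\wedge\omega^4$ mod $\{\omega^1\}$; $d\omega^2\equiv\omega^4\wedge\omega^5+\omega^3\wedge\omega^7$ mod $\{\omega^1,\omega^2\}$; $d\omega^3\equiv\omega^6\wedge\omega^7+\epsilon\omega^2\wedge\omega^5$ mod $\{\omega^1,\omega^3\}$; and, with $C(I_F,dM_i)$ the annihilator of $\{X\in I_F^\perp:X\lrcorner dM_i\subset I_F\}$ and superscripts denoting derived systems, $C(I_F,dM_1)=\{\omega^1,\dots,\omega^5\}$, $C(I_F,dM_1)^{(1)}=\{\omega^1,\omega^2,\omega^4,\omega^5\}$, $C(I_F,dM_1)^{(2)}=\{\omega^4,\omega^5\}$, $C(I_F,dM_2)=\{\omega^1,\omega^2,\omega^3,\omega^6,\omega^7\}$, $C(I_F,dM_2)^{(1)}=\{\omega^1,\omega^3,\omega^6,\omega^7\}$, $C(I_F,dM_2)^{(2)}=\{\omega^6,\omega^7\}$. These are the generic hyperbolic structure equations. ''Contact invariant'' means that contact-equivalent generic hyperbolic equations have the same $\epsilon$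 (in particular $\epsilon$ is independent of the choices made). The functions $I_1,I_2$: replacing $F$ by $-F$ if necessary one takes $F_s\ge0$, sets $\lambda_+=\frac{F_s}{2}+\sqrt{|F_rF_t-\frac14F_s^2|}$, and $I_i=i_F^*\tilde I_i$ with $$\tilde I_1=\det\begin{pmatrix}F_r&F_s&F_t\\ \lambda_+&F_t&0\\ (F_t/\lambda_+)_r&(F_t/\lambda_+)_s&(F_t/\lambda_+)_t\end{pmatrix},\quad \tilde I_2=\det\begin{pmatrix}0&F_r&\lambda_+\\ F_r&F_s&F_t\\ (F_r/\lambda_+)_r&(F_r/\lambda_+)_s&(F_r/\lambda_+)_t\end{pmatrix}.$$ *)

(* Defs.v *)
From HB Require Import structures.
From mathcomp Require Import all_boot all_order all_algebra all_fingroup.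
From mathcomp Require Import all_classical all_reals all_analysis.

Set Implicit Arguments.
Unset Strict Implicit.
Unset Printing Implicit Defensive.

Import Order.TTheory GRing.Theory Num.Theory.
Import numFieldNormedType.Exports.

Local Open Scope classical_set_scope.
Local Open Scope ring_scope.

Section Calculus.
Context {R : realType}.

Definition partial {n} {V : normedModType R} (i : 'I_n)
    (f : 'rV[R]_n -> V) : 'rV[R]_n -> V :=
  fun x => 'D_(delta_mx 0 i) f x.

(* C^oo on an open set: every iterated partial derivative exists and is
   (Frechet) differentiable at every point of the set. *)
Definition smooth {n} {V : normedModType R} (U : set 'rV[R]_n)
    (f : 'rV[R]_n -> V) : Prop :=
  forall (s : seq 'I_n) x, U x -> differentiable (foldr partial f s) x.

(* A diffeomorphism between open sets U and V, with inverse psi. *)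
Definition diffeo {n} (U V : set 'rV[R]_n)
    (phi psi : 'rV[R]_n -> 'rV[R]_n) : Prop :=
  [/\ open U, open V, smooth U phi & smooth V psi] /\
  [/\ forall x, U x -> V (phi x), forall y, V y -> U (psi y),
      forall x, U x -> psi (phi x) = x & forall y, V y -> phi (psi y) = y].

(* Vector fields and 1-forms are given by their rows of components in the
   standard coordinates; a 2-form Phi is given by its alternating matrix
   Phi i j = Phi(d/dx_i, d/dx_j). *)
Definition vector_field n := 'rV[R]_n -> 'rV[R]_n.
Definition one_form n := 'rV[R]_n -> 'rV[R]_n.
Definition two_form n := 'rV[R]_n -> 'M[R]_n.

Definition pairing {n} (eta : one_form n) (X : vector_field n) :
    'rV[R]_n -> R :=
  fun x => \sum_i eta x 0 i * X x 0 i.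

Definition wedge {n} (a b : one_form n) : two_form n :=
  fun x => \matrix_(i, j) (a x 0 i * b x 0 j - a x 0 j * b x 0 i).

Definition ext_d {n} (a : one_form n) : two_form n :=
  fun x => \matrix_(i, j)
    (partial i (fun y => a y 0 j) x - partial j (fun y => a y 0 i) x).

(* X contracted into the first slot of Phi *)
Definition interior {n} (X : vector_field n) (Phi : two_form n) : one_form n :=
  fun x => X x *m Phi x.

(* [jacobian f x] has entries (d f_j / d x_i)_(i, j), whence the transpose. *)
Definition pullback {m n} (f : 'rV[R]_m -> 'rV[R]_n) (a : one_form n) :
    one_form m :=
  fun x => a (f x) *m (jacobian f x)^T.

(* The coefficient of dx_1 /\ ... /\ dx_7 in Phi /\ Psi /\ a /\ b /\ c. *)
Definition top_wedge (Phi Psi : two_form 7) (a b c : one_form 7) :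
    'rV[R]_7 -> R :=
  fun x => 4^-1 * \sum_(s : 'S_7) (-1) ^+ s *
    (Phi x (s (inord 0)) (s (inord 1)) * Psi x (s (inord 2)) (s (inord 3)) *
     a x 0 (s (inord 4)) * b x 0 (s (inord 5)) * c x 0 (s (inord 6))).

End Calculus.

Arguments one_form R n : clear implicits.
Arguments two_form R n : clear implicits.
Arguments vector_field R n : clear implicits.

(* Pfaffian systems on an open set S of R^n are identified with the
   C^oo(S)-modules of their sections.  Forms are total functions, but their
   values outside S never matter. *)
Section Pfaffian.
Context {R : realType} {n : nat}.
Implicit Types (S : set 'rV[R]_n) (A I M : set (one_form R n)).

(* The C^oo(S)-module {A} generated by A *)
Definition generated S A : set (one_form R n) :=
  [set eta | exists k (f : 'I_k -> 'rV[R]_n -> R) (a : 'I_k -> one_form R n),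
     [/\ forall i, smooth S (f i), forall i, A (a i)
       & forall x, S x -> eta x = \sum_i f i x *: a i x]].

(* I consists of all smooth sections of a rank k subbundle D of T^*S
   (the fibre of D at x being the row space of [D x]). *)
Definition pfaffian_of_rank S I (k : nat) : Prop :=
  exists D : 'rV[R]_n -> 'M[R]_n,
    [/\ forall x, S x -> \rank (D x) = k,
        forall eta : one_form R n, I eta <->
          (smooth S eta /\ forall x, S x -> (eta x <= D x)%MS)
      & forall x v, S x -> (v <= D x)%MS -> exists2 eta, I eta & eta x = v].

(* Phi = Psi modulo the algebraic ideal generated by A *)
Definition congr_mod S A (Phi Psi : two_form R n) : Prop :=
  exists k (a b : 'I_k -> one_form R n),
    [/\ forall i, smooth S (a i), forall i, A (b i)
      & forall x, S x -> Phi x - Psi x = \sum_i wedge (a i) (b i) x].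

Definition derived_system S I : set (one_form R n) :=
  [set eta | I eta /\ congr_mod S I (ext_d eta) (fun=> 0)].

Definition perp S I : set (vector_field R n) :=
  [set X | smooth S X /\ forall eta, I eta ->
     forall x, S x -> pairing eta X x = 0].

Definition annihilator S (A : set (vector_field R n)) : set (one_form R n) :=
  [set eta | smooth S eta /\ forall X, A X ->
     forall x, S x -> pairing eta X x = 0].

(* C(I, dM); for M = I this is the Cauchy characteristic system of I. *)
Definition C_system S I M : set (one_form R n) :=
  annihilator S [set X | perp S I X /\
    forall eta, M eta -> I (interior X (ext_d eta))].

Definition has_class S I (k : nat) : Prop :=
  pfaffian_of_rank S (C_system S I I) k.

Definition coframe S (w : 'I_n -> one_form R n) : Prop :=
  (forall i, smooth S (w i)) /\
  (forall x, S x -> \matrix_(i, j) w i x 0 j \in unitmx).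

End Pfaffian.

Section SecondOrderEquations.
Context {R : realType}.

(* The coordinates (x, y, z, p, q, r, s, t) of J^2(R^2, R) *)
Definition jx : 'I_8 := inord 0.
Definition jy : 'I_8 := inord 1.
Definition jz : 'I_8 := inord 2.
Definition jp : 'I_8 := inord 3.
Definition jq : 'I_8 := inord 4.
Definition jr : 'I_8 := inord 5.
Definition js : 'I_8 := inord 6.
Definition jt : 'I_8 := inord 7.

Let dj (i : 'I_8) : 'rV[R]_8 := delta_mx 0 i.

Definition theta_z : one_form R 8 :=
  fun u => dj jz - u 0 jp *: dj jx - u 0 jq *: dj jy.
Definition theta_p : one_form R 8 :=
  fun u => dj jp - u 0 jr *: dj jx - u 0 js *: dj jy.
Definition theta_q : one_form R 8 :=
  fun u => dj jq - u 0 js *: dj jx - u 0 jt *: dj jy.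

(* The equation F = 0 on an open subset of J^2, with a parametrization i_F
   defined on Sigma_7. *)
Record equation := Equation {
  jet_domain : set 'rV[R]_8;
  eqF : 'rV[R]_8 -> R;
  Sigma : set 'rV[R]_7;
  iF : 'rV[R]_7 -> 'rV[R]_8 }.

Definition locus (E : equation) : set 'rV[R]_8 :=
  [set u | jet_domain E u /\ eqF E u = 0].

(* Row space: the tangent space d/dr, d/ds, d/dt of the fibres of J^2 -> J^1 *)
Definition fibre_tangent : 'M[R]_8 :=
  \sum_(i <- [:: jr; js; jt]) delta_mx i i.

Definition nondegenerate_parametrization (E : equation) : Prop :=
  [/\ open (jet_domain E) /\ smooth (jet_domain E) (eqF E),
      open (Sigma E) /\ smooth (Sigma E) (iF E),
      forall x, Sigma E x -> \rank (jacobian (iF E) x) = 7%N,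
      iF E @` Sigma E = locus E
    & forall x, Sigma E x -> row_full (jacobian (iF E) x + fibre_tangent)%MS].

Definition I_F (E : equation) : set (one_form R 7) :=
  generated (Sigma E)
    [set pullback (iF E) theta_z; pullback (iF E) theta_p;
         pullback (iF E) theta_q].

(* <phi, psi>_7 with respect to Vol = dx_1 /\ ... /\ dx_7 *)
Definition bilin7 (E : equation) (phi psi : one_form R 7) : 'rV[R]_7 -> R :=
  top_wedge (ext_d phi) (ext_d psi)
    (pullback (iF E) theta_z) (pullback (iF E) theta_p)
    (pullback (iF E) theta_q).

Definition isotropic (E : equation) (M : set (one_form R 7)) : Prop :=
  forall phi psi, M phi -> M psi ->
  forall x, Sigma E x -> bilin7 E phi psi x = 0.

Definition maximally_isotropic (E : equation) (M : set (one_form R 7)) : Prop :=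
  [/\ M `<=` I_F E, isotropic E M
    & forall N k, pfaffian_of_rank (Sigma E) N k -> N `<=` I_F E ->
        isotropic E N -> M `<=` N -> N = M].

Definition isotropic_labelling (E : equation) (M1 M2 : set (one_form R 7)) :
    Prop :=
  [/\ pfaffian_of_rank (Sigma E) M1 2 /\ maximally_isotropic E M1,
      pfaffian_of_rank (Sigma E) M2 2 /\ maximally_isotropic E M2
    & M1 <> M2].

Definition discr (F : 'rV[R]_8 -> R) : 'rV[R]_8 -> R :=
  fun u => partial jr F u * partial jt F u - 4^-1 * partial js F u ^+ 2.

Definition hyperbolic (E : equation) : Prop :=
  forall x, Sigma E x -> discr (eqF E) (iF E x) < 0.

Definition generic_hyperbolic (E : equation) (M1 M2 : set (one_form R 7)) :
    Prop :=
  [/\ nondegenerate_parametrization E, hyperbolic E,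
      isotropic_labelling E M1 M2, has_class (Sigma E) M1 7
    & has_class (Sigma E) M2 7].

(* The coframe w_1, ..., w_7 satisfies the generic hyperbolic structure
   equations with sign eps. *)
Definition structure_equations (E : equation) (M1 M2 : set (one_form R 7))
    (w : 'I_7 -> one_form R 7) (eps : R) : Prop :=
  let S := Sigma E in
  let w1 := w (inord 0) in let w2 := w (inord 1) in
  let w3 := w (inord 2) in let w4 := w (inord 3) in
  let w5 := w (inord 4) in let w6 := w (inord 5) in
  let w7 := w (inord 6) in
  let C1 := C_system S (I_F E) M1 in
  let C2 := C_system S (I_F E) M2 in
  [/\ coframe S w /\ (eps = 1 \/ eps = -1),
      [/\ I_F E = generated S [set w1; w2; w3],
          derived_system S (I_F E) = generated S [set w1],
          M1 = generated S [set w1; w2]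
        & M2 = generated S [set w1; w3]],
      [/\ congr_mod S [set w1] (ext_d w1)
            (fun x => wedge w3 w6 x + wedge w2 w4 x),
          congr_mod S [set w1; w2] (ext_d w2)
            (fun x => wedge w4 w5 x + wedge w3 w7 x)
        & congr_mod S [set w1; w3] (ext_d w3)
            (fun x => wedge w6 w7 x + eps *: wedge w2 w5 x)],
      [/\ C1 = generated S [set w1; w2; w3; w4; w5],
          derived_system S C1 = generated S [set w1; w2; w4; w5]
        & derived_system S (derived_system S C1) = generated S [set w4; w5]]
    & [/\ C2 = generated S [set w1; w2; w3; w6; w7],
          derived_system S C2 = generated S [set w1; w3; w6; w7]
        & derived_system S (derived_system S C2) = generated S [set w6; w7]]].

(* A diffeomorphism phi between nonempty open subsets W, W' of the parameter
   domains, with phi^* I_F' = I_F on W *)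
Definition contact_equivalent (E E' : equation) : Prop :=
  exists (W W' : set 'rV[R]_7) (phi psi : 'rV[R]_7 -> 'rV[R]_7),
    [/\ W !=set0, W `<=` Sigma E, W' `<=` Sigma E', diffeo W W' phi psi
      & generated W (pullback phi @` I_F E') = generated W (I_F E)].

Definition mx3 (rows : seq (seq R)) : 'M[R]_3 :=
  \matrix_(i, j) nth 0 (nth [::] rows i) j.

Definition lambda_plus (F : 'rV[R]_8 -> R) : 'rV[R]_8 -> R :=
  fun u => partial js F u / 2 + Num.sqrt `|discr F u|.

Definition tilde_I1 (F : 'rV[R]_8 -> R) : 'rV[R]_8 -> R :=
  fun u =>
  let g := fun v => partial jt F v / lambda_plus F v in
  \det (mx3 [:: [:: partial jr F u; partial js F u; partial jt F u];
                [:: lambda_plus F u; partial jt F u; 0];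
                [:: partial jr g u; partial js g u; partial jt g u]]).

Definition tilde_I2 (F : 'rV[R]_8 -> R) : 'rV[R]_8 -> R :=
  fun u =>
  let g := fun v => partial jr F v / lambda_plus F v in
  \det (mx3 [:: [:: 0; partial jr F u; lambda_plus F u];
                [:: partial jr F u; partial js F u; partial jt F u];
                [:: partial jr g u; partial js g u; partial jt g u]]).

End SecondOrderEquations.

Arguments equation R : clear implicits.

(* Main.v *)
Require Import Defs.
From mathcomp Require Import all_boot all_order all_algebra all_fingroup.
From mathcomp Require Import all_classical all_reals all_analysis.
From mathcomp Require Import ring lra.

Set Implicit Arguments.
Unset Strict Implicit.
Unset Printing Implicit Defensive.

Import Order.TTheory GRing.Theory Num.Theory.
Import numFieldNormedType.Exports.

Local Open Scope classical_set_scope.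
Local Open Scope ring_scope.

(* At a point, fix vectors f2, ..., f7 that pair with 1-forms t1, t2, t3 spanning
   I_F, and with their exterior derivatives, as the vectors dual to the structure
   coframe do, but only up to nonzero factors.  The product
     dt1(f3,f6) dt1(f2,f4) dt2(f4,f5) dt3(f6,f7) dt2(f3,f7) dt3(f2,f5)
   then has the sign of epsilon, whatever the choice of t1, t2, t3 with
   dt1 = 0 and dt2, dt3 decomposable modulo I_F: such a triple differs from
   (w1, w2, w3) by a diagonal or antidiagonal change modulo w1, and each factor
   it contributes to the product occurs squared.  Pulling back the structure
   coframe of a contact equivalent equation gives the invariance of epsilon.
   For the equation F = 0 put g = F_t / lambda_+ and h = F_r / lambda_+; then
   F_s = lambda_+ (1 + g h), the forms t2 = theta_p + g theta_q and
   t3 = h theta_p + theta_q generate the two isotropic systems modulo t1 = theta_z,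
   and with f7 = g^2 d/dr - g d/ds + d/dt, f5 = d/dr - h d/ds + h^2 d/dt the
   product is (1 - g h)^6 dg(f7) dh(f5), while I_1 = - lambda_+^2 dg(f7) and
   I_2 = - lambda_+^2 dh(f5). *)

(** * Symmetry of second directional derivatives *)

Section Young.
Context {R : realType} {V : normedModType R}.
Implicit Types (f : V -> R) (x v w : V).

Lemma is_derive_line f a v (s : R) :
  differentiable f (a + s *: v) ->
  is_derive s 1 (fun t : R => f (a + t *: v)) ('D_v f (a + s *: v)).
Proof.
move=> df.
have E : (fun h : R => h^-1 *: (((fun t : R => f (a + t *: v)) \o shift s)
      (h *: 1) - f (a + s *: v))) =
    (fun h => h^-1 *: ((f \o shift (a + s *: v)) (h *: v) - f (a + s *: v))).
  by apply/funext => h /=; rewrite [h *: 1]mulr1 scalerDl addrCA.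
apply: DeriveDef; last by rewrite /derive E.
by rewrite /derivable E; exact: diff_derivable.
Qed.

Lemma differentiable_approx f x : differentiable f x -> forall e : R, 0 < e ->
  exists2 d : R, 0 < d &
    forall y, `|y| < d -> `|f (x + y) - f x - 'D_y f x| <= e * `|y|.
Proof.
move=> df e e0.
have := diff_locallyxC df; set k := 'o _ => fE.
have /(littleoP [littleo of k]) /nbhs_ballP [d d0 Hd] := e0.
exists d => // y yd.
have -> : f (x + y) - f x - 'D_y f x = k y by rewrite fE deriveE //; ring.
by apply: Hd; rewrite -ball_normE /= sub0r normrN.
Qed.

(** The mean value theorem is applied to [u s = f (x + h *: w + s *: v) - f (x + s *: v)] on
    [[0, h]], and the two values of ['D_v f] that appear are replaced by their linear approximations
    at [x]. Differentiability of ['D_v f] at the single point [x] thus takes the place of continuity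
    of second derivatives. *)
Lemma second_difference f x v w :
  (\near x, differentiable f x) -> differentiable ('D_v f) x ->
  forall e : R, 0 < e -> exists2 d : R, 0 < d & forall h, 0 < h < d ->
   `|f (x + h *: v + h *: w) - f (x + h *: v) - f (x + h *: w) + f x
     - h ^+ 2 * 'D_w ('D_v f) x| <= e * h ^+ 2.
Proof.
move=> /nbhs_ballP [d1 /= d10 nf] dg e e0.
(* The approximation errors at [s *: v + h *: w] and at [s *: v] add up to at most [e / C] times [h]
   times [2 |v| + |w|]; the extra 1 makes [C] positive. *)
set C := `|v| *+ 2 + `|w| + 1.
have C0 : 0 < C by rewrite ltr_wpDl // addr_ge0 // mulrn_wge0.
have [d2 d20 Hg] := differentiable_approx dg (divr_gt0 e0 C0).
exists (Num.min d1 d2 / C); first by rewrite divr_gt0 // lt_min d10.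
move=> h /andP[h0]; rewrite ltr_pdivlMr // lt_min => /andP[hC1 hC2].
have small s : 0 <= s <= h -> `|s *: v + h *: w| <= h * (`|v| + `|w|) /\
    `|s *: v| <= h * `|v|.
  move=> /andP[s0 sh].
  have B : `|s *: v| <= h * `|v| by rewrite normrZ ger0_norm // ler_wpM2r.
  split => //; apply: (le_trans (ler_normD _ _)).
  by rewrite mulrDr lerD // normrZ ger0_norm // ltW.
have D1 : h * (`|v| + `|w|) < h * C.
  by rewrite ltr_pM2l // /C mulr2n; have := normr_ge0 v; lra.
have D2 : h * `|v| < h * C.
  by rewrite ltr_pM2l // /C mulr2n; have := normr_ge0 v; have := normr_ge0 w; lra.
pose u (s : R) := f (x + h *: w + s *: v) - f (x + s *: v).
have inb y : `|y| < d1 -> differentiable f (x + y).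
  by move=> yd; apply: nf; rewrite -ball_normE /= opprD addNKr normrN.
have du s : 0 <= s <= h -> is_derive s 1 u
    ('D_v f (x + h *: w + s *: v) - 'D_v f (x + s *: v)).
  move=> sh; have [S1 S2] := small _ sh.
  have I1 : differentiable f (x + h *: w + s *: v).
    rewrite -addrA [h *: w + _]addrC; apply: inb.
    exact: (le_lt_trans S1 (lt_trans D1 hC1)).
  have I2 : differentiable f (x + s *: v).
    by apply: inb; exact: (le_lt_trans S2 (lt_trans D2 hC1)).
  have := is_derive_line I1; have := is_derive_line I2 => ? ?.
  exact: is_deriveB.
have cu : {within `[0, h], continuous u}.
  apply: derivable_within_continuous => s sh.
  have /du : 0 <= s <= h by move: sh; rewrite in_itv.
  by move=> ?; exact: ex_derive.
have [s] := MVT_segment (ltW h0)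
  (fun s hs => du s (subset_itv_oo_cc hs)) cu.
rewrite in_itv => sh.
rewrite subr0 /u !scale0r !addr0 => E.
have [S1 S2] := small _ sh.
have G1 := Hg _ (le_lt_trans S1 (lt_trans D1 hC2)).
have G2 := Hg _ (le_lt_trans S2 (lt_trans D2 hC2)).
move: G1 G2; set g := 'D_v f in E dg *.
have -> : 'D_(s *: v + h *: w) g x = s *: 'D_v g x + h *: 'D_w g x.
  by rewrite !(deriveE _ dg) linearD !linearZ.
have -> : 'D_(s *: v) g x = s *: 'D_v g x by rewrite !(deriveE _ dg) linearZ.
set Dv := 'D_v g x; set Dw := 'D_w g x => G1 G2.
rewrite -[x + h *: w + s *: v]addrA [h *: w + s *: v]addrC in E.
rewrite [x + h *: v + h *: w]addrAC.
set X := (X in `|X|).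
(* The two linear parts differ by [h * Dw], which accounts for the [h ^+ 2 * Dw] in [X]; only the
   two remainders are left. *)
have {}E : X = h * ((g (x + (s *: v + h *: w)) - g x - (s *: Dv + h *: Dw)) -
  (g (x + s *: v) - g x - s *: Dv)).
  rewrite /X; transitivity ((g (x + (s *: v + h *: w)) - g (x + s *: v)) * h
    - h ^+ 2 * Dw); first by rewrite -E; ring.
  by rewrite /GRing.scale /=; ring.
rewrite {}E normrM gtr0_norm // expr2 mulrCA ler_pM2l //.
apply: (le_trans (ler_normB _ _)); apply: (le_trans (lerD G1 G2)).
rewrite -mulrDr -mulrA ler_pM2l // mulrC ler_pdivrMr //.
have := normr_ge0 v; have := normr_ge0 w => ? ?.
apply: (le_trans (lerD S1 S2)).
by rewrite -mulrDr ler_pM2l // /C mulr2n; lra.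
Qed.

(** The second difference is symmetric in [v] and [w], so both iterated derivatives, multiplied by
    [h ^+ 2], approximate it to within [e / 2 * h ^+ 2] for the same small [h]. *)
Lemma derive_comm f x v w : (\near x, differentiable f x) ->
  differentiable ('D_v f) x -> differentiable ('D_w f) x ->
  'D_w ('D_v f) x = 'D_v ('D_w f) x.
Proof.
move=> nf dv dw; apply/eqP; rewrite -subr_eq0 -normr_le0.
apply/ler_addgt0Pl => e e0; rewrite addr0.
have e20 : 0 < e / 2 by rewrite divr_gt0.
have [d1 d10 H1] := second_difference w nf dv e20.
have [d2 d20 H2] := second_difference v nf dw e20.
set h := Num.min d1 d2 / 2.
have m0 : 0 < Num.min d1 d2 by rewrite lt_min d10.
have h0 : 0 < h by rewrite divr_gt0.
have : h < Num.min d1 d2 by rewrite /h; lra.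
rewrite lt_min => /andP[h1 h2].
have {}H1 := H1 h; have {}H2 := H2 h.
rewrite h0 h1 in H1; rewrite h0 h2 in H2.
have := lerD (H1 isT) (H2 isT); rewrite -mulrDl -splitr => H.
have := le_trans (ler_normB _ _) H.
rewrite [x + h *: w + h *: v]addrAC.
move: ('D_w _ x) ('D_v ('D_w f) x) => Da Db.
set X := (X in `|X|).
have -> : X = - (h ^+ 2 * (Da - Db)) by rewrite /X; ring.
have h20 : 0 < h ^+ 2 by rewrite exprn_gt0.
by rewrite normrN normrM gtr0_norm // [leRHS]mulrC ler_pM2l.
Qed.

End Young.

(** * Differentiability depends only on the germ *)

Section Germs.
Context {R : realType} {V W : normedModType R}.
Implicit Types (f g : V -> W) (x : V).

(** The first order expansion of [f] at [x] is one of [g] as well, and the continuous linear map in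
    such an expansion is the differential by uniqueness. *)
Lemma near_eq_differentiable f g x :
  (\near x, f x = g x) -> differentiable f x -> differentiable g x.
Proof.
move=> fg df; have fgx : f x = g x := nbhs_singleton fg.
have gE : g \o shift x = cst (g x) + 'd f x +o_ (0 : V) id.
  have fE := diff_locally df.
  apply/eqaddoP => e e0.
  have /eqaddoP/(_ _ e0) := fE.
  apply: filter_app.
  have : \forall y \near (0 : V), f (shift x y) = g (shift x y).
    by move: fg; rewrite (near_shift 0) subr0.
  apply: filter_app; near=> y.
  by rewrite !fctE /= fgx => ->.
apply/diff_locallyP.
have -> : 'd g x = 'd f x :> (V -> W).
  by apply: diff_unique => //; exact: diff_continuous.
by split => //; exact: diff_continuous.
Unshelve. all: by end_near. Qed.

End Germs.

Lemma partialE {R : realType} n (V : normedModType R) (f : 'rV[R]_n -> V)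
    (x : 'rV[R]_n) (i : 'I_n) :
  differentiable f x -> partial i f x = 'd f x (delta_mx 0 i).
Proof. exact: deriveE. Qed.

(** * Rules for partial derivatives, and the chain rule *)

Section PartialDerivatives.
Context {R : realType} {n : nat}.
Implicit Types (x : 'rV[R]_n) (i j : 'I_n).

Lemma differentiable_entry (V : normedModType R) m p (f : V -> 'M[R]_(m, p))
    (x : V) (i : 'I_m) (j : 'I_p) :
  differentiable f x -> differentiable (fun y => f y i j) x.
Proof.
move=> df.
exact: (differentiable_comp df (differentiable_coord (f x) i j)).
Qed.

Lemma partial_entry m (f : 'rV[R]_n -> 'rV[R]_m) x i k :
  differentiable f x -> partial i (fun y => f y 0 k) x = partial i f x 0 k.
Proof.
by move=> df; rewrite /partial derive_mx ?mxE //; exact: diff_derivable.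
Qed.

Lemma jacobianE m (f : 'rV[R]_n -> 'rV[R]_m) x i k :
  differentiable f x -> jacobian f x i k = partial i (fun y => f y 0 k) x.
Proof.
move=> df; rewrite partial_entry // /partial deriveEjacobian //.
by rewrite -rowE [RHS]mxE.
Qed.

Lemma near_eq_partial (V : normedModType R) (f g : 'rV[R]_n -> V) x i :
  (\near x, f x = g x) -> partial i f x = partial i g x.
Proof. exact: near_eq_derive. Qed.

Lemma partialM (f g : 'rV[R]_n -> R) x i :
  differentiable f x -> differentiable g x ->
  partial i (fun y => f y * g y) x = partial i f x * g x + f x * partial i g x.
Proof.
move=> df dg; rewrite /partial deriveM; try exact: diff_derivable.
by rewrite addrC /GRing.scale /= [g x * _]mulrC.
Qed.

Lemma partialD (f g : 'rV[R]_n -> R) x i :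
  differentiable f x -> differentiable g x ->
  partial i (fun y => f y + g y) x = partial i f x + partial i g x.
Proof. by move=> df dg; rewrite /partial deriveD; try exact: diff_derivable. Qed.

Lemma sum_fctE p (h : 'I_p -> 'rV[R]_n -> R) :
  (fun y => \sum_k h k y) = \sum_k h k.
Proof. by apply/funext => y; rewrite fct_sumE. Qed.

Lemma partial_sum p (h : 'I_p -> 'rV[R]_n -> R) x i :
  (forall k, differentiable (h k) x) ->
  partial i (fun y => \sum_k h k y) x = \sum_k partial i (h k) x.
Proof.
move=> dh; rewrite sum_fctE /partial derive_sum // => k.
exact: diff_derivable.
Qed.

Lemma partial_cst (c : R) x i : partial i (fun=> c) x = 0.
Proof. exact: derive_cst. Qed.

Lemma partial_coord x i j : partial i (fun y => y 0 j) x = (i == j)%:R.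
Proof.
rewrite (partial_entry (f := id)) // /partial derive_id mxE eqxx /=.
by rewrite eq_sym.
Qed.

Lemma partial_comp m (g : 'rV[R]_m -> R) (f : 'rV[R]_n -> 'rV[R]_m) x i :
  differentiable f x -> differentiable g (f x) ->
  partial i (g \o f) x = \sum_k jacobian f x i k * partial k g (f x).
Proof.
move=> df dg; have dgf : differentiable (g \o f) x by exact: differentiable_comp.
rewrite (partialE i dgf) (diff_comp df dg) /=.
have -> : 'd f x (delta_mx 0 i) = \sum_k jacobian f x i k *: delta_mx 0 k.
  by rewrite -partialE // [LHS]row_sum_delta; apply: eq_bigr => k _;
    rewrite jacobianE // partial_entry.
by rewrite linear_sum; apply: eq_bigr => k _; rewrite linearZ partialE.
Qed.

End PartialDerivatives.

(** * The exterior derivative and its naturality under pullback *)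

Section ExteriorDerivative.
Context {R : realType}.

Lemma smooth_differentiable n (V : normedModType R) (U : set 'rV[R]_n)
    (f : 'rV[R]_n -> V) x : smooth U f -> U x -> differentiable f x.
Proof. by move=> sf; exact: (sf [::]). Qed.

Lemma smooth_partial n (V : normedModType R) (U : set 'rV[R]_n)
    (f : 'rV[R]_n -> V) i : smooth U f -> smooth U (partial i f).
Proof.
(* [foldr] applies the last index of the list first, so the extra derivative goes to the end. *)
by move=> sf s x Ux; have := sf (rcons s i) x Ux; rewrite -cats1 foldr_cat.
Qed.

(** The entries of [jacobian] are identified with partial derivatives at points of
    differentiability, hence the passage to germs on the open set [U]. *)
Lemma smooth_jacobian n m (U : set 'rV[R]_n) (f : 'rV[R]_n -> 'rV[R]_m) x i k :
  open U -> smooth U f -> U x ->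
  differentiable (fun y => jacobian f y i k) x.
Proof.
move=> oU sf Ux.
apply: (@near_eq_differentiable _ _ _ (fun y => partial i f y 0 k)).
  near=> y; rewrite jacobianE ?partial_entry //;
    by apply: (smooth_differentiable sf); near: y; exact: open_nbhs_nbhs.
exact: differentiable_entry (smooth_differentiable (smooth_partial i sf) Ux).
Unshelve. all: by end_near. Qed.

Lemma partial_jacobianC n m (U : set 'rV[R]_n) (f : 'rV[R]_n -> 'rV[R]_m) x i j k :
  open U -> smooth U f -> U x ->
  partial i (fun y => jacobian f y j k) x =
  partial j (fun y => jacobian f y i k) x.
Proof.
move=> oU sf Ux.
have nU : \forall y \near x, U y by exact: open_nbhs_nbhs.
have dfk : \forall y \near x, differentiable (fun z => f z 0 k) y.
  near=> y; apply: differentiable_entry; apply: (smooth_differentiable sf).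
  by near: y.
have E l : \forall y \near x, jacobian f y l k = partial l (fun z => f z 0 k) y.
  near=> y; apply: jacobianE; apply: (smooth_differentiable sf).
  by near: y.
have D l : differentiable (partial l (fun z => f z 0 k)) x.
  exact: near_eq_differentiable (E l) (smooth_jacobian l k oU sf Ux).
rewrite (near_eq_partial i (E j)) (near_eq_partial j (E i)).
exact: (derive_comm dfk (D j) (D i)).
Unshelve. all: by end_near. Qed.

(** In the product rule, the terms that differentiate the Jacobian contain second derivatives of
    [f]; these are symmetric in the two indices and cancel. The chain rule terms make up the matrix
    product. *)
Lemma ext_d_pullback n m (U : set 'rV[R]_n) (f : 'rV[R]_n -> 'rV[R]_m)
    (a : one_form R m) x :
  open U -> smooth U f -> U x -> differentiable a (f x) ->
  ext_d (pullback f a) x =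
    jacobian f x *m ext_d a (f x) *m (jacobian f x)^T.
Proof.
move=> oU sf Ux da.
have df := smooth_differentiable sf Ux.
have dak k : differentiable (fun y => a y 0 k) (f x) by exact: differentiable_entry.
have dafk k : differentiable ((fun y => a y 0 k) \o f) x.
  exact: differentiable_comp.
have P i j : partial i (fun y => pullback f a y 0 j) x =
    \sum_k \sum_l jacobian f x i l * partial l (fun y => a y 0 k) (f x)
             * jacobian f x j k +
    \sum_k a (f x) 0 k * partial i (fun y => jacobian f y j k) x.
  have -> : (fun y => pullback f a y 0 j) =
      (fun y => \sum_k (((fun y => a y 0 k) \o f) y * jacobian f y j k)).
    apply/funext => y; rewrite /pullback mxE; apply: eq_bigr => k _.
    by rewrite [in LHS]mxE.
  rewrite partial_sum -?big_split /=; last first.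
    by move=> k; exact: (differentiableM (dafk k) (smooth_jacobian j k oU sf Ux)).
  apply: eq_bigr => k _.
  rewrite (partialM i (dafk k) (smooth_jacobian j k oU sf Ux)).
  by rewrite (partial_comp i df (dak k)) mulr_suml.
apply/matrixP => i j; rewrite [LHS]mxE !P.
under [X in _ - (_ + X)]eq_bigr do rewrite (partial_jacobianC j i _ oU sf Ux).
rewrite opprD addrACA subrr addr0.
move: (jacobian f x) => J.
rewrite -!mulmxA [RHS]mxE [X in X - _]exchange_big /= -sumrB; apply: eq_bigr => l _.
rewrite [in RHS]mxE mulr_sumr -sumrB; apply: eq_bigr => k _.
rewrite !mxE; ring.
Qed.

Lemma ext_d_near n (a b : one_form R n) x :
  (\near x, a x = b x) -> ext_d a x = ext_d b x.
Proof.
move=> ab; apply/matrixP => i j; rewrite !mxE.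
have E k : \forall y \near x, a y 0 k = b y 0 k by near=> y; rewrite (near ab y).
by rewrite (near_eq_partial i (E j)) (near_eq_partial j (E i)).
Unshelve. all: by end_near. Qed.

Definition gradient n (f : 'rV[R]_n -> R) : one_form R n :=
  fun x => \row_i partial i f x.

Lemma ext_d_scale n (f : 'rV[R]_n -> R) (a : one_form R n) x :
  differentiable f x -> differentiable a x ->
  ext_d (fun y => f y *: a y) x = f x *: ext_d a x + wedge (gradient f) a x.
Proof.
move=> df da; apply/matrixP => i j.
have P k l : partial k (fun y => (f y *: a y) 0 l) x =
    partial k f x * a x 0 l + f x * partial k (fun y => a y 0 l) x.
  have -> : (fun y => (f y *: a y) 0 l) = (fun y => f y * a y 0 l).
    by apply/funext => y; rewrite mxE.
  exact: (partialM k df (differentiable_entry 0 l da)).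
by rewrite mxE !P !mxE; ring.
Qed.

Lemma ext_dD n (a b : one_form R n) x :
  differentiable a x -> differentiable b x ->
  ext_d (fun y => a y + b y) x = ext_d a x + ext_d b x.
Proof.
move=> da db; apply/matrixP => i j.
have P k l : partial k (fun y => (a y + b y) 0 l) x =
    partial k (fun y => a y 0 l) x + partial k (fun y => b y 0 l) x.
  have -> : (fun y => (a y + b y) 0 l) = (fun y => a y 0 l + b y 0 l).
    by apply/funext => y; rewrite mxE.
  exact: (partialD k (differentiable_entry 0 l da) (differentiable_entry 0 l db)).
by rewrite mxE !P !mxE; ring.
Qed.

End ExteriorDerivative.

(** * Values of 1-forms and 2-forms on tangent vectors *)

Section Evaluation.
Context {R : realType} {n : nat}.
Implicit Types (a b X Y : 'rV[R]_n) (P Q : 'M[R]_n).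

Definition ev1 a X : R := (a *m X^T) 0 0.
Definition ev2 P X Y : R := (X *m P *m Y^T) 0 0.
Definition ev_wedge a b X Y : R := ev1 a X * ev1 b Y - ev1 a Y * ev1 b X.

Lemma ev1E a X : ev1 a X = \sum_i a 0 i * X 0 i.
Proof. by rewrite /ev1 mxE; apply: eq_bigr => i _; rewrite mxE. Qed.

Lemma ev1D a b X : ev1 (a + b) X = ev1 a X + ev1 b X.
Proof. by rewrite /ev1 mulmxDl mxE. Qed.

Lemma ev1B a b X : ev1 (a - b) X = ev1 a X - ev1 b X.
Proof. by rewrite /ev1 mulmxBl 2!mxE [X in _ + X]mxE. Qed.

Lemma ev1Z (c : R) a X : ev1 (c *: a) X = c * ev1 a X.
Proof. by rewrite /ev1 -scalemxAl mxE. Qed.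

Lemma ev1N a X : ev1 (- a) X = - ev1 a X.
Proof. by rewrite /ev1 mulNmx mxE. Qed.

Lemma ev1Dr a X Y : ev1 a (X + Y) = ev1 a X + ev1 a Y.
Proof. by rewrite /ev1 linearD /= mulmxDr mxE. Qed.

Lemma ev1Zr (c : R) a X : ev1 a (c *: X) = c * ev1 a X.
Proof. by rewrite /ev1 linearZ /= -scalemxAr mxE. Qed.

Lemma ev1_sum k (a : 'I_k -> 'rV[R]_n) X :
  ev1 (\sum_i a i) X = \sum_i ev1 (a i) X.
Proof. by rewrite /ev1 mulmx_suml summxE. Qed.

Lemma ev1_delta i X : ev1 (delta_mx 0 i) X = X 0 i.
Proof. by rewrite /ev1 -rowE !mxE. Qed.

Lemma ev2D P Q X Y : ev2 (P + Q) X Y = ev2 P X Y + ev2 Q X Y.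
Proof. by rewrite /ev2 mulmxDr mulmxDl mxE. Qed.

Lemma ev2B P Q X Y : ev2 (P - Q) X Y = ev2 P X Y - ev2 Q X Y.
Proof. by rewrite /ev2 mulmxBr mulmxBl 2!mxE [X in _ + X]mxE. Qed.

Lemma ev2Z (c : R) P X Y : ev2 (c *: P) X Y = c * ev2 P X Y.
Proof. by rewrite /ev2 -scalemxAr -scalemxAl mxE. Qed.

Lemma ev2_sum k (P : 'I_k -> 'M[R]_n) X Y :
  ev2 (\sum_i P i) X Y = \sum_i ev2 (P i) X Y.
Proof. by rewrite /ev2 mulmx_sumr mulmx_suml summxE. Qed.

Lemma ev2_0 X Y : ev2 0 X Y = 0.
Proof. by rewrite /ev2 mulmx0 mul0mx mxE. Qed.

Lemma ev2_wedge (a b : one_form R n) x X Y :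
  ev2 (wedge a b x) X Y = ev_wedge (a x) (b x) X Y.
Proof.
have -> : wedge a b x = (a x)^T *m b x - (b x)^T *m a x.
  apply/matrixP => i j; rewrite !mxE !big_ord1 !mxE.
  by congr (_ - _); rewrite mulrC.
have E (u v : 'rV[R]_n) : ev2 (u^T *m v) X Y = ev1 u X * ev1 v Y.
  rewrite /ev2 mulmxA -mulmxA mxE big_ord1 /ev1; congr (_ * _).
  by rewrite -[u in RHS]trmxK -trmx_mul [RHS]mxE.
by rewrite ev2B !E /ev_wedge [ev1 (b x) X * _]mulrC.
Qed.

End Evaluation.

Lemma ev1_pull {R : realType} m n (a : 'rV[R]_n) (J : 'M[R]_(m, n)) X :
  ev1 (a *m J^T) X = ev1 a (X *m J).
Proof. by rewrite /ev1 trmx_mul mulmxA. Qed.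

Lemma ev2_pull {R : realType} m n (P : 'M[R]_n) (J : 'M[R]_(m, n)) X Y :
  ev2 (J *m P *m J^T) X Y = ev2 P (X *m J) (Y *m J).
Proof. by rewrite /ev2 trmx_mul !mulmxA. Qed.

(** The difference is a sum of wedge products with one factor in [A], and these vanish on two
    vectors that every element of [A] kills at [x]. *)
Lemma congr_mod_ev {R : realType} n (S : set 'rV[R]_n) A (Phi Psi : two_form R n)
    (x X Y : 'rV[R]_n) :
  congr_mod S A Phi Psi -> S x ->
  (forall b, A b -> ev1 (b x) X = 0 /\ ev1 (b x) Y = 0) ->
  ev2 (Phi x) X Y = ev2 (Psi x) X Y.
Proof.
move=> [k [a [b [_ Ab E]]]] Sx H; apply/eqP; rewrite -subr_eq0 -ev2B E //.
rewrite ev2_sum big1 // => i _; rewrite ev2_wedge /ev_wedge.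
by have [-> ->] := H _ (Ab i); rewrite !mulr0 subrr.
Qed.

Lemma generated_ev {R : realType} n (S : set 'rV[R]_n) A (eta : one_form R n)
    (x X : 'rV[R]_n) :
  Defs.generated S A eta -> S x -> (forall b, A b -> ev1 (b x) X = 0) ->
  ev1 (eta x) X = 0.
Proof.
move=> [k [f [a [_ Aa E]]]] Sx H; rewrite E // ev1_sum big1 // => i _.
by rewrite ev1Z H // mulr0.
Qed.

(** * Pointwise linear algebra of test frames *)

Section TestFrame.
Context {R : realType} {n : nat}.

(* f2, ..., f7 behave like the vectors dual to the structure coframe in the
   structure equations of t1, t2, t3, up to scale. *)
Definition test_frame (t1 t2 t3 : 'rV[R]_n) (T1 T2 T3 : 'M[R]_n)
    (f2 f3 f4 f5 f6 f7 : 'rV[R]_n) : Prop :=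
  [/\ (forall f, f \in [:: f2; f3; f4; f5; f6; f7] -> ev1 t1 f = 0) /\
      (forall f, f \in [:: f4; f5; f6; f7] -> ev1 t2 f = 0 /\ ev1 t3 f = 0),
      ev1 t2 f3 = 0 /\ ev1 t3 f2 = 0,
      [/\ ev2 T1 f3 f4 = 0, ev2 T1 f3 f5 = 0, ev2 T1 f3 f7 = 0 & ev2 T2 f4 f7 = 0],
      [/\ ev2 T1 f2 f5 = 0, ev2 T1 f2 f6 = 0, ev2 T1 f2 f7 = 0 & ev2 T3 f6 f5 = 0]
    & [/\ ev2 T1 f3 f6 != 0, ev2 T1 f2 f4 != 0, ev2 T2 f4 f5 != 0
        & ev2 T3 f6 f7 != 0]].

Definition orientation (T1 T2 T3 : 'M[R]_n) (f2 f3 f4 f5 f6 f7 : 'rV[R]_n) : R :=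
  ev2 T1 f3 f6 * ev2 T1 f2 f4 * ev2 T2 f4 f5 * ev2 T3 f6 f7 *
  (ev2 T2 f3 f7 * ev2 T3 f2 f5).

(** The vanishing conditions annihilate enough off-diagonal values of the coframe on the test
    vectors that the six factors become monomials in [a], [b], [c] and the diagonal values. Each of
    these occurs exactly twice, so the product is a square times [e2 * e3]. The terms in [b'] and
    [c'] stem from the [w1]-components of [t2] and [t3]. *)
Lemma orientation_sign (w : 'I_7 -> 'rV[R]_n) (t1 t2 t3 : 'rV[R]_n)
    (T1 T2 T3 : 'M[R]_n) f2 f3 f4 f5 f6 f7 (e2 e3 a b b' c c' : R)
    (w1 := w (inord 0)) (w2 := w (inord 1)) (w3 := w (inord 2))
    (w4 := w (inord 3)) (w5 := w (inord 4)) (w6 := w (inord 5))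
    (w7 := w (inord 6)) :
  a != 0 -> b != 0 -> c != 0 ->
  t1 = a *: w1 -> t2 = b' *: w1 + b *: w2 -> t3 = c' *: w1 + c *: w3 ->
  (forall X Y, ev1 w1 X = 0 -> ev1 w1 Y = 0 ->
    ev2 T1 X Y = a * (ev_wedge w3 w6 X Y + ev_wedge w2 w4 X Y)) ->
  (forall X Y, ev1 w1 X = 0 -> ev1 w1 Y = 0 -> ev1 w2 X = 0 -> ev1 w2 Y = 0 ->
    ev2 T2 X Y = b' * ev_wedge w3 w6 X Y +
      b * (ev_wedge w4 w5 X Y + e2 * ev_wedge w3 w7 X Y)) ->
  (forall X Y, ev1 w1 X = 0 -> ev1 w1 Y = 0 -> ev1 w3 X = 0 -> ev1 w3 Y = 0 ->
    ev2 T3 X Y = c' * ev_wedge w2 w4 X Y +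
      c * (ev_wedge w6 w7 X Y + e3 * ev_wedge w2 w5 X Y)) ->
  test_frame t1 t2 t3 T1 T2 T3 f2 f3 f4 f5 f6 f7 ->
  exists2 k : R, 0 < k & orientation T1 T2 T3 f2 f3 f4 f5 f6 f7 = k * (e2 * e3).
Proof.
move=> a0 b0 c0 t1E t2E t3E H1 H2 H3.
case=> [[F1 F23] [F32 F23'] [E34 E35 E37 E47] [E25 E26 E27 E65] [N36 N24 N45 N67]].
have W1 f : f \in [:: f2; f3; f4; f5; f6; f7] -> ev1 w1 f = 0.
  move=> /F1 /eqP; rewrite t1E ev1Z mulf_eq0 (negPf a0) => /eqP; exact.
have W2 f : ev1 w1 f = 0 -> ev1 t2 f = 0 -> ev1 w2 f = 0.
  move=> w0 /eqP; rewrite t2E ev1D !ev1Z w0 mulr0 add0r mulf_eq0 (negPf b0).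
  by move=> /eqP.
have W3 f : ev1 w1 f = 0 -> ev1 t3 f = 0 -> ev1 w3 f = 0.
  move=> w0 /eqP; rewrite t3E ev1D !ev1Z w0 mulr0 add0r mulf_eq0 (negPf c0).
  by move=> /eqP.
have W12 : ev1 w1 f2 = 0 by apply: W1; rewrite !inE eqxx ?orbT.
have W13 : ev1 w1 f3 = 0 by apply: W1; rewrite !inE eqxx ?orbT.
have W14 : ev1 w1 f4 = 0 by apply: W1; rewrite !inE eqxx ?orbT.
have W15 : ev1 w1 f5 = 0 by apply: W1; rewrite !inE eqxx ?orbT.
have W16 : ev1 w1 f6 = 0 by apply: W1; rewrite !inE eqxx ?orbT.
have W17 : ev1 w1 f7 = 0 by apply: W1; rewrite !inE eqxx ?orbT.
have W23 : ev1 w2 f3 = 0 by apply: W2.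
have W32 : ev1 w3 f2 = 0 by apply: W3.
have [K f0] : (ev1 t2 f4 = 0 /\ ev1 t3 f4 = 0) /\ (ev1 t2 f5 = 0 /\ ev1 t3 f5 = 0)
  by split; apply: F23; rewrite !inE eqxx ?orbT.
have W24 := W2 _ W14 K.1; have W34 := W3 _ W14 K.2.
have W25 := W2 _ W15 f0.1; have W35 := W3 _ W15 f0.2.
have {K f0} [K f0] : (ev1 t2 f6 = 0 /\ ev1 t3 f6 = 0) /\ (ev1 t2 f7 = 0 /\ ev1 t3 f7 = 0)
  by split; apply: F23; rewrite !inE eqxx ?orbT.
have W26 := W2 _ W16 K.1; have W36 := W3 _ W16 K.2.
have W27 := W2 _ W17 f0.1; have W37 := W3 _ W17 f0.2.
rewrite /orientation.
rewrite (H1 f3 f4) // in E34; rewrite (H1 f3 f5) // in E35.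
rewrite (H1 f3 f7) // in E37; rewrite (H2 f4 f7) // in E47.
rewrite (H1 f2 f5) // in E25; rewrite (H1 f2 f6) // in E26.
rewrite (H1 f2 f7) // in E27; rewrite (H3 f6 f5) // in E65.
rewrite (H1 f3 f6) // in N36 *; rewrite (H1 f2 f4) // in N24 *.
rewrite (H2 f4 f5) // in N45 *; rewrite (H3 f6 f7) // in N67 *.
rewrite (H2 f3 f7) // (H3 f2 f5) //.
move: E34 E35 E37 E47 E25 E26 E27 E65 N36 N24 N45 N67.
rewrite /ev_wedge !(W23, W32, W24, W34, W25, W35, W26, W36, W27, W37).
rewrite !(mul0r, mulr0, oppr0, addr0, add0r).
set x33 := ev1 w3 f3; set x22 := ev1 w2 f2.
move=> E34 E35 E37 E47 E25 E26 E27 E65 N36 N24 N45 N67.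
have x33n : x33 != 0 by apply: contraNneq N36 => ->; rewrite !(mul0r, mulr0).
have x22n : x22 != 0 by apply: contraNneq N24 => ->; rewrite !(mul0r, mulr0).
have Z (u v z : R) : u != 0 -> v != 0 -> u * (v * z) = 0 -> z = 0.
  move=> u0 v0 /eqP; rewrite !mulf_eq0 (negPf u0) (negPf v0) => /eqP; exact.
(* For distinct indices, [xij] says that [wi] vanishes on [fj]. The relations read off from [T1]
   remove the [b'] and [c'] terms from [ev2 T2 f3 f7] and [ev2 T3 f2 f5]. *)
have x64 := Z _ _ _ a0 x33n E34. have x65 := Z _ _ _ a0 x33n E35.
have x67 := Z _ _ _ a0 x33n E37.
have x45 := Z _ _ _ a0 x22n E25. have x46 := Z _ _ _ a0 x22n E26.
have x47 := Z _ _ _ a0 x22n E27.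
move: N36 N24 N45 N67 E47 E65; rewrite !(x64, x65, x67, x45, x46, x47).
rewrite !(mul0r, mulr0, oppr0, addr0, add0r).
set x66 := ev1 w6 f6; set x44 := ev1 w4 f4.
move=> N36 N24 N45 N67.
have x44n : x44 != 0 by apply: contraNneq N24 => ->; rewrite !(mul0r, mulr0).
have x66n : x66 != 0 by apply: contraNneq N36 => ->; rewrite !(mul0r, mulr0).
move=> /(Z _ _ _ b0 x44n) x57 /(Z _ _ _ c0 x66n) x75.
rewrite x57 x75 !(mul0r, mulr0, oppr0, addr0, add0r).
set x55 := ev1 w5 f5 in N45 *; set x77 := ev1 w7 f7 in N67 *.
have x55n : x55 != 0 by apply: contraNneq N45 => ->; rewrite !(mul0r, mulr0).
have x77n : x77 != 0 by apply: contraNneq N67 => ->; rewrite !(mul0r, mulr0).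
exists ((a * b * c * x33 * x22 * x44 * x55 * x66 * x77) ^+ 2).
  by rewrite exprn_even_gt0 //= !mulf_neq0.
ring.
Qed.

End TestFrame.

Lemma differentiable_row {R : realType} n (V : normedModType R) (f : V -> 'rV[R]_n) (x : V) :
  (forall j, differentiable (fun y => f y 0 j) x) -> differentiable f x.
Proof.
move=> df.
have -> : f = \sum_j (fun y => f y 0 j *: delta_mx 0 j).
  by apply/funext => y; rewrite fct_sumE -row_sum_delta.
by apply: differentiable_sum => j; exact: differentiableZl.
Qed.

Lemma differentiable_scale {R : realType} n (V : normedModType R) (c : V -> R)
    (f : V -> 'rV[R]_n) (x : V) :
  differentiable c x -> differentiable f x ->
  differentiable (fun y => c y *: f y) x.
Proof.
move=> dc df; apply: differentiable_row => j.
have -> : (fun y => (c y *: f y) 0 j) = (fun y => c y * f y 0 j).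
  by apply/funext => y; rewrite mxE.
exact: differentiableM dc (differentiable_entry 0 j df).
Qed.

(** * Local independence of the sign from the choice of generators *)

Section LocalInvariance.
Context {R : realType}.
Implicit Types (U : set 'rV[R]_7) (w : 'I_7 -> one_form R 7) (x y X Y : 'rV[R]_7).

(* The structure equations with a coefficient e2 in front of w3 /\ w7, so that
   exchanging the two isotropic subsystems exchanges e2 and e3. *)
Definition structure_on U w (e2 e3 : R) : Prop :=
  let w1 := w (inord 0) in let w2 := w (inord 1) in
  let w3 := w (inord 2) in let w4 := w (inord 3) in
  let w5 := w (inord 4) in let w6 := w (inord 5) in
  let w7 := w (inord 6) in
  forall y, U y ->
  [/\ (forall i, differentiable (w i) y) /\
      (exists e : 'I_7 -> 'rV[R]_7, forall i j, ev1 (w i y) (e j) = (i == j)%:R),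
      forall X Y, ev1 (w1 y) X = 0 -> ev1 (w1 y) Y = 0 ->
        ev2 (ext_d w1 y) X Y =
        ev_wedge (w3 y) (w6 y) X Y + ev_wedge (w2 y) (w4 y) X Y,
      forall X Y, ev1 (w1 y) X = 0 -> ev1 (w1 y) Y = 0 ->
        ev1 (w2 y) X = 0 -> ev1 (w2 y) Y = 0 ->
        ev2 (ext_d w2 y) X Y =
        ev_wedge (w4 y) (w5 y) X Y + e2 * ev_wedge (w3 y) (w7 y) X Y
    & forall X Y, ev1 (w1 y) X = 0 -> ev1 (w1 y) Y = 0 ->
        ev1 (w3 y) X = 0 -> ev1 (w3 y) Y = 0 ->
        ev2 (ext_d w3 y) X Y =
        ev_wedge (w6 y) (w7 y) X Y + e3 * ev_wedge (w2 y) (w5 y) X Y].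

(** With indices from 0, this exchanges [w2] with [w3], [w4] with [w6] and [w5] with [w7], that is,
    the roles of the two isotropic subsystems. *)
Definition swap7 (i : 'I_7) : 'I_7 := inord (nth 0%N [:: 0; 2; 1; 5; 6; 3; 4]%N i).

Lemma swap7K : involutive swap7.
Proof.
case=> [[|[|[|[|[|[|[|//]]]]]]] hi]; apply: val_inj;
  by rewrite /swap7 /= !inordK.
Qed.

Lemma structure_on_swap U w e2 e3 :
  structure_on U w e2 e3 -> structure_on U (w \o swap7) e3 e2.
Proof.
have E k l : (k < 7)%N -> nth 0%N [:: 0; 2; 1; 5; 6; 3; 4]%N k = l ->
    swap7 (inord k) = inord l by move=> k7 <-; rewrite /swap7 inordK.
move=> H; rewrite /structure_on /= => y Uy; have [[dw [e he]] H1 H2 H3] := H y Uy.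
rewrite (E 0%N 0%N) // (E 1%N 2%N) // (E 2%N 1%N) // (E 3%N 5%N) //.
rewrite (E 4%N 6%N) // (E 5%N 3%N) // (E 6%N 4%N) //.
split => //.
- split; first by move=> i; exact: dw.
  exists (e \o swap7) => i j; rewrite /= he (inj_eq (can_inj swap7K)) //.
- by move=> X Y X1 Y1; rewrite H1 // addrC.
Qed.

Lemma ext_d_comb3 (t w1 w2 w3 : one_form R 7) (c1 c2 c3 : 'rV[R]_7 -> R) x X Y :
  (\near x, t x = c1 x *: w1 x + c2 x *: w2 x + c3 x *: w3 x) ->
  differentiable c1 x -> differentiable c2 x -> differentiable c3 x ->
  differentiable w1 x -> differentiable w2 x -> differentiable w3 x ->
  ev2 (ext_d t x) X Y =
   c1 x * ev2 (ext_d w1 x) X Y + ev_wedge (gradient c1 x) (w1 x) X Y +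
   (c2 x * ev2 (ext_d w2 x) X Y + ev_wedge (gradient c2 x) (w2 x) X Y) +
   (c3 x * ev2 (ext_d w3 x) X Y + ev_wedge (gradient c3 x) (w3 x) X Y).
Proof.
move=> tE dc1 dc2 dc3 dw1 dw2 dw3; rewrite (ext_d_near tE).
rewrite (ext_dD (a := fun y => c1 y *: w1 y + c2 y *: w2 y)); last first.
- exact: differentiable_scale.
- by apply: differentiableD; exact: differentiable_scale.
rewrite ext_dD; try exact: differentiable_scale.
by rewrite !ext_d_scale // !ev2D !ev2Z !ev2_wedge.
Qed.

Lemma gradient_cst n (c : R) (z : 'rV[R]_n) : gradient (fun=> c) z = 0.
Proof. by apply/rowP => i; rewrite !mxE partial_cst. Qed.

Lemma ev_wedge0l n (u X Y : 'rV[R]_n) : ev_wedge 0 u X Y = 0.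
Proof. by rewrite /ev_wedge /ev1 !mul0mx !mxE !mul0r subrr. Qed.

Lemma ev_wedge_kerl n (u v X Y : 'rV[R]_n) :
  ev1 u X = 0 -> ev1 u Y = 0 -> ev_wedge u v X Y = 0.
Proof. by rewrite /ev_wedge => -> ->; rewrite !mul0r subrr. Qed.

Lemma ev_wedge_kerr n (u v X Y : 'rV[R]_n) :
  ev1 v X = 0 -> ev1 v Y = 0 -> ev_wedge u v X Y = 0.
Proof. by rewrite /ev_wedge => -> ->; rewrite !mulr0 subrr. Qed.

(** Differentiating the coefficients produces only terms with a factor [w1], [w2] or [w3] that
    vanishes on the vectors tested, so the pointwise formula applies with the coefficients frozen at
    [x]. *)
Lemma local_sign_diag U x w e2 e3 (t1 t2 t3 : one_form R 7)
    (a b b' c c' : 'rV[R]_7 -> R) f2 f3 f4 f5 f6 f7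
    (w1 := w (inord 0)) (w2 := w (inord 1)) (w3 := w (inord 2)) :
  structure_on U w e2 e3 -> U x ->
  differentiable a x -> differentiable b x -> differentiable b' x ->
  differentiable c x -> differentiable c' x ->
  a x != 0 -> b x != 0 -> c x != 0 ->
  (\near x, t1 x = a x *: w1 x) ->
  (\near x, t2 x = b' x *: w1 x + b x *: w2 x) ->
  (\near x, t3 x = c' x *: w1 x + c x *: w3 x) ->
  test_frame (t1 x) (t2 x) (t3 x) (ext_d t1 x) (ext_d t2 x) (ext_d t3 x)
    f2 f3 f4 f5 f6 f7 ->
  exists2 k : R, 0 < k &
    orientation (ext_d t1 x) (ext_d t2 x) (ext_d t3 x) f2 f3 f4 f5 f6 f7
    = k * (e2 * e3).
Proof.
move=> H Ux da db db' dc dc' a0 b0 c0 t1E t2E t3E.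
have [[dw _] H1 H2 H3] := H x Ux.
have d0 : differentiable (fun=> 0 : R) x by exact: differentiable_cst.
have t1E' : \near x, t1 x = a x *: w1 x + 0 *: w2 x + 0 *: w3 x.
  by near=> y; rewrite (near t1E y) // !scale0r !addr0.
have t2E' : \near x, t2 x = b' x *: w1 x + b x *: w2 x + 0 *: w3 x.
  by near=> y; rewrite (near t2E y) // !scale0r !addr0.
have t3E' : \near x, t3 x = c' x *: w1 x + 0 *: w2 x + c x *: w3 x.
  by near=> y; rewrite (near t3E y) // !scale0r !addr0.
apply: (@orientation_sign _ _ (fun i => w i x) _ _ _ _ _ _ _ _ _ _ _ _ e2 e3
  (a x) (b x) (b' x) (c x) (c' x)) => //.
- exact: (nbhs_singleton t1E).
- exact: (nbhs_singleton t2E).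
- exact: (nbhs_singleton t3E).
- move=> X Y X1 Y1.
  rewrite (ext_d_comb3 X Y t1E' da d0 d0 (dw _) (dw _) (dw _)) H1 //.
  rewrite gradient_cst !ev_wedge0l (ev_wedge_kerr _ X1 Y1).
  by rewrite !(mul0r, add0r, addr0).
- move=> X Y X1 Y1 X2 Y2.
  rewrite (ext_d_comb3 X Y t2E' db' db d0 (dw _) (dw _) (dw _)) H1 // H2 //.
  rewrite gradient_cst !ev_wedge0l (ev_wedge_kerr _ X1 Y1) (ev_wedge_kerr _ X2 Y2).
  by rewrite (ev_wedge_kerl _ X2 Y2) !mul0r !addr0.
- move=> X Y X1 Y1 X3 Y3.
  rewrite (ext_d_comb3 X Y t3E' dc' d0 dc (dw _) (dw _) (dw _)) H1 // H3 //.
  rewrite gradient_cst !ev_wedge0l (ev_wedge_kerr _ X1 Y1) (ev_wedge_kerr _ X3 Y3).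
  by rewrite (ev_wedge_kerl _ X3 Y3) !(mul0r, add0r, addr0).
Unshelve. all: by end_near. Qed.

(** Half of the 4-form [P /\ P] on the four vectors; its vanishing expresses that the 2-form is
    decomposable. *)
Definition plucker n (P : 'M[R]_n) (X Y Z T : 'rV[R]_n) : R :=
  ev2 P X Y * ev2 P Z T - ev2 P X Z * ev2 P Y T + ev2 P X T * ev2 P Y Z.

Lemma near_neq0 (f : 'rV[R]_7 -> R) x :
  differentiable f x -> f x != 0 -> \near x, f x != 0.
Proof.
move=> /differentiable_continuous cf fx.
exact: cvgr_neq0 cf fx.
Qed.

(** On the kernel of [w1], [w2], [w3], the derivative of the [i]-th form is [A i k2] times
    [w4 /\ w5] plus [A i k3] times [w6 /\ w7]. The hypothesis on [t1] therefore kills [A k1 k2] and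
    [A k1 k3], and the Pluecker relations give [A i k2 * A i k3 = 0] in the other two rows. Hence
    near [x] the change of generators is diagonal or antidiagonal modulo [w1]. The conditions are
    imposed on all of [U] because exterior derivatives at [x] depend on the coefficients near
    [x]. *)
Lemma local_sign U x w e2 e3 (t1 t2 t3 : one_form R 7)
    (A : 'I_3 -> 'I_3 -> 'rV[R]_7 -> R) f2 f3 f4 f5 f6 f7
    (w1 := w (inord 0)) (w2 := w (inord 1)) (w3 := w (inord 2))
    (k1 := inord 0 : 'I_3) (k2 := inord 1 : 'I_3) (k3 := inord 2 : 'I_3)
    (ker := fun y X => [/\ ev1 (t1 y) X = 0, ev1 (t2 y) X = 0 & ev1 (t3 y) X = 0]) :
  open U -> U x -> structure_on U w e2 e3 ->
  (forall i j y, U y -> differentiable (A i j) y) ->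
  (forall y, U y -> t1 y = A k1 k1 y *: w1 y + A k1 k2 y *: w2 y + A k1 k3 y *: w3 y) ->
  (forall y, U y -> t2 y = A k2 k1 y *: w1 y + A k2 k2 y *: w2 y + A k2 k3 y *: w3 y) ->
  (forall y, U y -> t3 y = A k3 k1 y *: w1 y + A k3 k2 y *: w2 y + A k3 k3 y *: w3 y) ->
  (forall X, ker x X -> [/\ ev1 (w1 x) X = 0, ev1 (w2 x) X = 0 & ev1 (w3 x) X = 0]) ->
  (forall y X Y, U y -> ker y X -> ker y Y -> ev2 (ext_d t1 y) X Y = 0) ->
  (forall y X Y Z T, U y -> ker y X -> ker y Y -> ker y Z -> ker y T ->
    plucker (ext_d t2 y) X Y Z T = 0 /\ plucker (ext_d t3 y) X Y Z T = 0) ->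
  test_frame (t1 x) (t2 x) (t3 x) (ext_d t1 x) (ext_d t2 x) (ext_d t3 x)
    f2 f3 f4 f5 f6 f7 ->
  exists2 k : R, 0 < k &
    orientation (ext_d t1 x) (ext_d t2 x) (ext_d t3 x) f2 f3 f4 f5 f6 f7
    = k * (e2 * e3).
Proof.
move=> oU Ux H dA T1 T2 T3 kerw Z1 P23 F.
have nU y : U y -> \near y, U y by move=> Uy; exact: open_nbhs_nbhs.
have nT (t : one_form R 7) i :
    (forall y, U y -> t y = A i k1 y *: w1 y + A i k2 y *: w2 y + A i k3 y *: w3 y) ->
    forall y, U y -> \near y, t y = A i k1 y *: w1 y + A i k2 y *: w2 y + A i k3 y *: w3 y.
  by move=> E y Uy; near=> z; apply: E; near: z; exact: nU.
have V (t : one_form R 7) i :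
    (forall y, U y -> t y = A i k1 y *: w1 y + A i k2 y *: w2 y + A i k3 y *: w3 y) ->
    forall y X Y, U y -> ev1 (w1 y) X = 0 -> ev1 (w1 y) Y = 0 ->
    ev1 (w2 y) X = 0 -> ev1 (w2 y) Y = 0 -> ev1 (w3 y) X = 0 -> ev1 (w3 y) Y = 0 ->
    ev2 (ext_d t y) X Y =
      A i k2 y * ev_wedge (w (inord 3) y) (w (inord 4) y) X Y +
      A i k3 y * ev_wedge (w (inord 5) y) (w (inord 6) y) X Y.
  move=> E y X Y Uy X1 Y1 X2 Y2 X3 Y3.
  have [[dw _] H1 H2 H3] := H y Uy.
  rewrite (ext_d_comb3 X Y (nT _ _ E _ Uy)) //; do ?exact: dA; do ?exact: dw.
  rewrite H1 // H2 // H3 //.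
  rewrite !(ev_wedge_kerr _ X1 Y1) !(ev_wedge_kerr _ X2 Y2) !(ev_wedge_kerr _ X3 Y3).
  rewrite !(ev_wedge_kerl _ X3 Y3) !(ev_wedge_kerl _ X2 Y2).
  by rewrite !(mulr0, addr0, add0r).
have inordE k l : (k < 7)%N -> (l < 7)%N -> (inord k == inord l :> 'I_7) = (k == l).
  by move=> k7 l7; rewrite -val_eqE /= !inordK.
(* The relations are tested on [e (inord 3)], ..., [e (inord 6)], dual to [w4], ..., [w7], which
   span the common kernel of [w1], [w2], [w3]. *)
have L : forall y, U y -> [/\ A k1 k2 y = 0, A k1 k3 y = 0, A k2 k2 y * A k2 k3 y = 0
    & A k3 k2 y * A k3 k3 y = 0].
  move=> y Uy; have [[_ [e he]] _ _ _] := H y Uy.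
  have he' k l : (k < 7)%N -> (l < 7)%N -> ev1 (w (inord k) y) (e (inord l)) = (k == l)%:R.
    by move=> k7 l7; rewrite he inordE.
  have ke l : (2 < l < 7)%N -> [/\ ev1 (w1 y) (e (inord l)) = 0,
      ev1 (w2 y) (e (inord l)) = 0 & ev1 (w3 y) (e (inord l)) = 0].
    by move=> /andP[l2 l7]; rewrite !he' //; move: l2; case: l l7 => [|[|[|]]].
  have kt l : (2 < l < 7)%N -> ker y (e (inord l)).
    move=> /ke [E1 E2 E3].
    by rewrite /ker T1 // T2 // T3 // !ev1D !ev1Z E1 E2 E3 !mulr0 !addr0.
  have VV (t : one_form R 7) i k l :
    (forall y, U y -> t y = A i k1 y *: w1 y + A i k2 y *: w2 y + A i k3 y *: w3 y) ->
     (2 < k < 7)%N -> (2 < l < 7)%N -> ev2 (ext_d t y) (e (inord k)) (e (inord l)) =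
     A i k2 y * ((k == 3)%:R * (l == 4)%:R - (l == 3)%:R * (k == 4)%:R) +
     A i k3 y * ((k == 5)%:R * (l == 6)%:R - (l == 5)%:R * (k == 6)%:R).
    move=> E kb lb; have [? ? ?] := ke _ kb; have [? ? ?] := ke _ lb.
    move/andP: kb => [k2b k7]; move/andP: lb => [l2b l7].
    by rewrite (V _ _ E) // /ev_wedge !he' // ![_ == k]eq_sym ![_ == l]eq_sym.
  have R1 := VV _ _ 3 4 T1 isT isT; rewrite Z1 //= in R1; do ?exact: kt.
  have R2 := VV _ _ 5 6 T1 isT isT; rewrite Z1 //= in R2; do ?exact: kt.
  move: R1 R2; rewrite !(mulr0, mulr1, mul0r, subr0, addr0, add0r) => R1 R2.
  have [||||P2 P3] := P23 y (e (inord 3)) (e (inord 4)) (e (inord 5)) (e (inord 6)) Uy;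
    try exact: kt.
  have PE (t : one_form R 7) i :
    (forall y, U y -> t y = A i k1 y *: w1 y + A i k2 y *: w2 y + A i k3 y *: w3 y) ->
    plucker (ext_d t y) (e (inord 3)) (e (inord 4)) (e (inord 5)) (e (inord 6)) =
    A i k2 y * A i k3 y.
    move=> E; rewrite /plucker (VV t i 3 4)%N // (VV t i 5 6)%N // (VV t i 3 5)%N //.
    rewrite (VV t i 4 6)%N // (VV t i 3 6)%N // (VV t i 4 5)%N //=; ring.
  rewrite (PE _ _ T2) in P2; rewrite (PE _ _ T3) in P3.
  by split.
have [_ _ Q2 Q3] := L x Ux.
have [[F1 F23] _ _ _ [_ _ N45 N67]] := F.
have kf f : f \in [:: f4; f5; f6; f7] -> [/\ ev1 (w1 x) f = 0, ev1 (w2 x) f = 0 & ev1 (w3 x) f = 0].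
  move=> hf; apply: kerw; have [? ?] := F23 f hf; split => //.
  by apply: F1; rewrite 2!in_cons hf !orbT.
(* Otherwise [ext_d t2 x] would vanish on the common kernel, although its value on [f4], [f5] is
   nonzero. *)
have B2 : A k2 k2 x != 0 \/ A k2 k3 x != 0.
  have [/= E2|] := eqVneq (A k2 k2 x) 0; last by left.
  have [/= E3|] := eqVneq (A k2 k3 x) 0; last by right.
  have [|? ? ?] := kf f4; first by rewrite !inE eqxx ?orbT.
  have [|? ? ?] := kf f5; first by rewrite !inE eqxx ?orbT.
  by move: N45; rewrite (V _ _ T2) // E2 E3 !mul0r addr0 eqxx.
have B3 : A k3 k2 x != 0 \/ A k3 k3 x != 0.
  have [/= E2|] := eqVneq (A k3 k2 x) 0; last by left.
  have [/= E3|] := eqVneq (A k3 k3 x) 0; last by right.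
  have [|? ? ?] := kf f6; first by rewrite !inE eqxx ?orbT.
  have [|? ? ?] := kf f7; first by rewrite !inE eqxx ?orbT.
  by move: N67; rewrite (V _ _ T3) // E2 E3 !mul0r addr0 eqxx.
have [[_ [e he]] _ _ _] := H x Ux.
have he' k l : (k < 7)%N -> (l < 7)%N -> ev1 (w (inord k) x) (e (inord l)) = (k == l)%:R.
  by move=> k7 l7; rewrite he inordE.
have [L12 L13 _ _] := L x Ux.
(* The coefficient matrix is injective at [x]: a vector with [w]-components [u1], [u2], [u3] that is
   killed by the [ti] is killed by the [wi]. *)
have inj (u1 u2 u3 : R) : A k1 k1 x * u1 = 0 ->
    A k2 k1 x * u1 + A k2 k2 x * u2 + A k2 k3 x * u3 = 0 ->
    A k3 k1 x * u1 + A k3 k2 x * u2 + A k3 k3 x * u3 = 0 ->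
    [/\ u1 = 0, u2 = 0 & u3 = 0].
  move=> E1 E2 E3.
  pose X := u1 *: e (inord 0) + u2 *: e (inord 1) + u3 *: e (inord 2).
  have X1 : ev1 (w1 x) X = u1 by rewrite /X !ev1Dr !ev1Zr !he' //=; ring.
  have X2 : ev1 (w2 x) X = u2 by rewrite /X !ev1Dr !ev1Zr !he' //=; ring.
  have X3 : ev1 (w3 x) X = u3 by rewrite /X !ev1Dr !ev1Zr !he' //=; ring.
  have [|] := kerw X; last by rewrite X1 X2 X3.
  by rewrite /ker T1 // T2 // T3 // !ev1D !ev1Z X1 X2 X3 L12 L13 !mul0r !addr0.
(* An entry that is nonzero at [x] stays so nearby, and the product relation then makes the other
   entry vanish near [x]. *)
have nonzero_near i j (h : 'rV[R]_7 -> R) : A i j x != 0 ->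
    (forall y, U y -> A i j y * h y = 0) -> \near x, h x = 0.
  move=> Aij Ah; have nA := near_neq0 (dA i j x Ux) Aij.
  near=> y; have Aijy : A i j y != 0 by near: y.
  have /eqP : A i j y * h y = 0 by apply: Ah; near: y; exact: nU.
  by rewrite mulf_eq0 (negPf Aijy) => /eqP.
have nt1 : \near x, t1 x = A k1 k1 x *: w1 x.
  near=> y; have Uy : U y by near: y; exact: nU.
  by have [E2 E3 _ _] := L y Uy; rewrite T1 // E2 E3 !scale0r !addr0.
have nt (t : one_form R 7) i (ja jb : 'I_3) (u v : one_form R 7) :
    (forall y, U y -> t y = A i k1 y *: w1 y + A i ja y *: u y + A i jb y *: v y) ->
    (\near x, A i jb x = 0) -> \near x, t x = A i k1 x *: w1 x + A i ja x *: u x.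
  move=> E nA; near=> y; rewrite E; last by near: y; exact: nU.
  by rewrite (near nA y) // scale0r addr0.
have flip (t : one_form R 7) i :
    (forall y, U y -> t y = A i k1 y *: w1 y + A i k2 y *: w2 y + A i k3 y *: w3 y) ->
    (forall y, U y -> t y = A i k1 y *: w1 y + A i k3 y *: w3 y + A i k2 y *: w2 y).
  by move=> E y Uy; rewrite E // addrAC.
have M2 y : U y -> A k2 k2 y * A k2 k3 y = 0 by move=> /L [].
have M3 y : U y -> A k3 k2 y * A k3 k3 y = 0 by move=> /L [].
have M2' y : U y -> A k2 k3 y * A k2 k2 y = 0 by rewrite mulrC; exact: M2.
have M3' y : U y -> A k3 k3 y * A k3 k2 y = 0 by rewrite mulrC; exact: M3.
have one0 : (1 : R) <> 0 by apply/eqP; exact: oner_neq0.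
(* Rows 2 and 3 cannot single out the same [wi], since the matrix would be singular. This leaves the
   diagonal case and the antidiagonal one, which [swap7] reduces to it. *)
case: B2 => [A22|A23]; case: B3 => [A32|A33].
- have n23 := nonzero_near _ _ _ A22 M2; have n33 := nonzero_near _ _ _ A32 M3.
  have [|||_ _ /one0 //] := inj 0 0 1; try by rewrite !mulr0.
    by rewrite (nbhs_singleton n23); ring.
  by rewrite (nbhs_singleton n33); ring.
- have n23 := nonzero_near _ _ _ A22 M2; have n32 := nonzero_near _ _ _ A33 M3'.
  apply: (local_sign_diag H Ux (dA k1 k1 x Ux) (dA k2 k2 x Ux) (dA k2 k1 x Ux)
    (dA k3 k3 x Ux) (dA k3 k1 x Ux)) => //.
  + apply/eqP => A11.
    (* If [A k1 k1] vanished at [x], solving rows 2 and 3 with [u1 = 1] would give a nonzero kernel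
       vector. *)
    have [|||/one0 //] := inj 1 (- (A k2 k1 x / A k2 k2 x)) (- (A k3 k1 x / A k3 k3 x)).
    * by rewrite A11 mul0r.
    * by rewrite (nbhs_singleton n23); field; rewrite ?A22 ?A33.
    * by rewrite (nbhs_singleton n32); field; rewrite ?A22 ?A33.
  + exact: (nt _ _ _ _ _ _ T2 n23).
  + exact: (nt _ _ _ _ _ _ (flip _ _ T3) n32).
- have n22 := nonzero_near _ _ _ A23 M2'; have n33 := nonzero_near _ _ _ A32 M3.
  rewrite [e2 * e3]mulrC.
  have E k l : (k < 7)%N -> nth 0%N [:: 0; 2; 1; 5; 6; 3; 4]%N k = l ->
    swap7 (inord k) = inord l by move=> k7 <-; rewrite /swap7 inordK.
  apply: (local_sign_diag (structure_on_swap H) Ux (dA k1 k1 x Ux) (dA k2 k3 x Ux)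
    (dA k2 k1 x Ux) (dA k3 k2 x Ux) (dA k3 k1 x Ux)) => //.
  + apply/eqP => A11.
    have [|||/one0 //] := inj 1 (- (A k3 k1 x / A k3 k2 x)) (- (A k2 k1 x / A k2 k3 x)).
    * by rewrite A11 mul0r.
    * by rewrite (nbhs_singleton n22); field; rewrite ?A23 ?A32.
    * by rewrite (nbhs_singleton n33); field; rewrite ?A23 ?A32.
  + by rewrite /= (E 0%N 0%N).
  + by rewrite /= (E 0%N 0%N) // (E 1%N 2%N) //; exact: (nt _ _ _ _ _ _ (flip _ _ T2) n22).
  + by rewrite /= (E 0%N 0%N) // (E 2%N 1%N) //; exact: (nt _ _ _ _ _ _ T3 n33).
- have n22 := nonzero_near _ _ _ A23 M2'; have n32 := nonzero_near _ _ _ A33 M3'.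
  have [|||_ /one0 //] := inj 0 1 0; try by rewrite !mulr0.
    by rewrite (nbhs_singleton n22); ring.
  by rewrite (nbhs_singleton n32); ring.
Unshelve. all: by end_near. Qed.
End LocalInvariance.

(** * Sections of generated modules as combinations of three forms *)

Section Generated.
Context {R : realType} {n : nat}.
Implicit Types (U S : set 'rV[R]_n) (eta : one_form R n).

Lemma smooth_cst (V : normedModType R) U (c : V) : smooth U (fun=> c).
Proof.
move=> s x _; elim/last_ind: s c => [|s i IHs] c; first exact: differentiable_cst.
rewrite -cats1 foldr_cat /=.
have -> : partial i (fun=> c) = fun=> 0 by apply/funext => y; exact: derive_cst.
exact: IHs.
Qed.

Lemma generated_mem U A eta : A eta -> Defs.generated U A eta.
Proof.
move=> Aeta; exists 1%N, (fun _ _ => 1), (fun=> eta); split => // [i|x _].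
  exact: smooth_cst.
by rewrite big_ord1 scale1r.
Qed.

(** The coefficients are merely differentiable. This suffices for one exterior derivative and admits
    the quotients by [lambda_plus], which are proved differentiable. *)
Definition combination U (a1 a2 a3 eta : one_form R n) : Prop :=
  exists c : 'I_3 -> 'rV[R]_n -> R,
    (forall i y, U y -> differentiable (c i) y) /\
    (forall y, U y -> eta y = c (inord 0) y *: a1 y + c (inord 1) y *: a2 y
                              + c (inord 2) y *: a3 y).

Lemma combination_sub U S (a1 a2 a3 eta : one_form R n) :
  U `<=` S -> combination S a1 a2 a3 eta -> combination U a1 a2 a3 eta.
Proof.
by move=> US [c [dc cE]]; exists c; split => [i y /US|y /US]; [exact: dc|exact: cE].
Qed.

Lemma generated_combination U A (a1 a2 a3 eta : one_form R n) :
  (forall b, A b -> combination U a1 a2 a3 b) ->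
  Defs.generated U A eta -> combination U a1 a2 a3 eta.
Proof.
move=> H [k [f [a [sf Aa E]]]].
have [C HC] := choice (fun i => H _ (Aa i)).
exists (fun j y => \sum_i f i y * C i j y); split => [j y Uy|y Uy].
  rewrite sum_fctE; apply: differentiable_sum => i.
  by apply: differentiableM; [exact: (sf i [::])|exact: (HC i).1].
rewrite E // !scaler_suml -!big_split /=; apply: eq_bigr => i _.
by rewrite (HC i).2 // !scalerDr !scalerA.
Qed.

Lemma combination_basis U (a1 a2 a3 b : one_form R n) :
  [set a1; a2; a3] b -> combination U a1 a2 a3 b.
Proof.
have inj3 k l : (k < 3)%N -> (l < 3)%N -> (inord k == inord l :> 'I_3) = (k == l).
  by move=> k3 l3; rewrite -val_eqE /= !inordK.
have D k : exists c : 'I_3 -> 'rV[R]_n -> R, c = fun i _ => (i == k)%:R by eexists.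
case=> [[->|->]|->].
- have [c cE] := D (inord 0); exists c; rewrite cE; split => [i y _|y _].
    exact: differentiable_cst.
  by rewrite !inj3 //= scale1r !scale0r !addr0.
- have [c cE] := D (inord 1); exists c; rewrite cE; split => [i y _|y _].
    exact: differentiable_cst.
  by rewrite !inj3 //= scale1r !scale0r add0r addr0.
- have [c cE] := D (inord 2); exists c; rewrite cE; split => [i y _|y _].
    exact: differentiable_cst.
  by rewrite !inj3 //= scale1r !scale0r !add0r.
Qed.

Lemma generated3_combination U (a1 a2 a3 eta : one_form R n) :
  Defs.generated U [set a1; a2; a3] eta -> combination U a1 a2 a3 eta.
Proof. by apply: generated_combination => b; exact: combination_basis. Qed.

End Generated.

(** * Test frames under pullback *)

Section Pull.
Context {R : realType} {m n : nat}.
Variable J : 'M[R]_(m, n).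

Lemma test_frame_pull (t1 t2 t3 : 'rV[R]_n) (T1 T2 T3 : 'M[R]_n) f2 f3 f4 f5 f6 f7 :
  test_frame t1 t2 t3 T1 T2 T3 (f2 *m J) (f3 *m J) (f4 *m J) (f5 *m J) (f6 *m J)
    (f7 *m J) ->
  test_frame (t1 *m J^T) (t2 *m J^T) (t3 *m J^T) (J *m T1 *m J^T) (J *m T2 *m J^T)
    (J *m T3 *m J^T) f2 f3 f4 f5 f6 f7.
Proof.
case=> -[H1 H2] H3 H4 H5 H6; split; rewrite ?ev1_pull ?ev2_pull //.
split=> f hf.
  by rewrite ev1_pull; apply: H1; exact: (map_f (mulmx^~ J) hf).
by rewrite !ev1_pull; apply: H2; exact: (map_f (mulmx^~ J) hf).
Qed.

Lemma orientation_pull (T1 T2 T3 : 'M[R]_n) f2 f3 f4 f5 f6 f7 :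
  orientation (J *m T1 *m J^T) (J *m T2 *m J^T) (J *m T3 *m J^T) f2 f3 f4 f5 f6 f7 =
  orientation T1 T2 T3 (f2 *m J) (f3 *m J) (f4 *m J) (f5 *m J) (f6 *m J) (f7 *m J).
Proof. by rewrite /orientation !ev2_pull. Qed.

End Pull.

(** * Contact invariance of the sign *)

Section ContactInvariance.
Context {R : realType}.

Lemma dual_frame (w : 'I_7 -> 'rV[R]_7) : \matrix_(i, j) w i 0 j \in unitmx ->
  exists e : 'I_7 -> 'rV[R]_7, forall i j, ev1 (w i) (e j) = (i == j)%:R.
Proof.
set M := \matrix_(i, j) _ => uM.
exists (fun j => (col j (invmx M))^T) => i j.
have -> : w i = row i M by apply/rowP => k; rewrite !mxE.
have -> : (i == j)%:R = (M *m invmx M) i j by rewrite mulmxV // mxE.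
rewrite /ev1 trmxK !mxE; apply: eq_bigr => k _; rewrite mxE; congr (_ * _).
by rewrite mxE.
Qed.

Lemma structure_equations_on (E : equation R) M1 M2 w eps :
  structure_equations E M1 M2 w eps -> structure_on (Sigma E) w 1 eps.
Proof.
case=> -[[sw uw] _] _ [D1 D2 D3] _ _; rewrite /structure_on => y Sy; split.
- split; first by move=> i; exact: smooth_differentiable (sw i) Sy.
  exact: dual_frame (uw y Sy).
- move=> X Y X1 Y1; rewrite (congr_mod_ev D1 Sy) ?ev2D ?ev2_wedge //.
  by move=> b ->.
- move=> X Y X1 Y1 X2 Y2; rewrite (congr_mod_ev D2 Sy) ?ev2D ?ev2_wedge ?mul1r //.
  by move=> b [] ->.
- move=> X Y X1 Y1 X2 Y2; rewrite (congr_mod_ev D3 Sy) ?ev2D ?ev2Z ?ev2_wedge //.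
  by move=> b [] ->.
Qed.

Lemma structure_on_sub (U S : set 'rV[R]_7) w (e2 e3 : R) :
  U `<=` S -> structure_on S w e2 e3 -> structure_on U w e2 e3.
Proof. by move=> US H; rewrite /structure_on => y /US; exact: H. Qed.

(** The model case: on the dual vectors every factor of [orientation] is 1 except the last two,
    which are [e2] and [e3]. As indices start at 0, [e (inord k)] is the test vector with number
    [k + 1]. *)
Lemma dual_test_frame (U : set 'rV[R]_7) (w : 'I_7 -> one_form R 7) (e2 e3 : R)
    (y : 'rV[R]_7) (e : 'I_7 -> 'rV[R]_7) (D : nat -> 'M[R]_7) :
  structure_on U w e2 e3 -> U y ->
  (forall i j, ev1 (w i y) (e j) = (i == j)%:R) ->
  (forall k, D k = ext_d (w (inord k)) y) ->
  test_frame (w (inord 0) y) (w (inord 1) y) (w (inord 2) y) (D 0%N) (D 1%N) (D 2%N)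
    (e (inord 1)) (e (inord 2)) (e (inord 3)) (e (inord 4)) (e (inord 5))
    (e (inord 6)) /\
  orientation (D 0%N) (D 1%N) (D 2%N)
    (e (inord 1)) (e (inord 2)) (e (inord 3)) (e (inord 4)) (e (inord 5))
    (e (inord 6)) = e2 * e3.
Proof.
move=> H Uy he DE; have [_ H1 H2 H3] := H y Uy.
have he' k l : (k < 7)%N -> (l < 7)%N ->
    ev1 (w (inord k) y) (e (inord l)) = (k == l)%:R.
  by move=> k7 l7; rewrite he -val_eqE /= !inordK.
have E1 k l : (0 < k < 7)%N -> (0 < l < 7)%N -> ev2 (D 0%N) (e (inord k)) (e (inord l)) =
    (k == 2)%:R * (l == 5)%:R - (l == 2)%:R * (k == 5)%:R +
    ((k == 1)%:R * (l == 3)%:R - (l == 1)%:R * (k == 3)%:R).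
  move=> kb lb; have [/andP[k0 k7] /andP[l0 l7]] := (kb, lb).
  have Z i : (0 < i < 7)%N -> ev1 (w (inord 0) y) (e (inord i)) = 0.
    by move=> /andP[i0 i7]; rewrite he' // (ltn_eqF i0).
  rewrite DE H1 ?Z // /ev_wedge !he' //.
  by rewrite ![_ == k]eq_sym ![_ == l]eq_sym.
have E2 k l : (1 < k < 7)%N -> (1 < l < 7)%N -> ev2 (D 1%N) (e (inord k)) (e (inord l)) =
    (k == 3)%:R * (l == 4)%:R - (l == 3)%:R * (k == 4)%:R +
    e2 * ((k == 2)%:R * (l == 6)%:R - (l == 2)%:R * (k == 6)%:R).
  move=> kb lb; have [/andP[k1 k7] /andP[l1 l7]] := (kb, lb).
  have Z i j : (j < 2)%N -> (1 < i < 7)%N -> ev1 (w (inord j) y) (e (inord i)) = 0.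
    move=> j2 /andP[i1 i7]; rewrite he' //; last by apply: (leq_trans j2).
    by rewrite ltn_eqF // (leq_trans j2).
  rewrite DE H2 ?Z // /ev_wedge !he' //.
  by rewrite ![_ == k]eq_sym ![_ == l]eq_sym.
have E3 k l : (k == 1%N) || (2 < k < 7)%N -> (l == 1%N) || (2 < l < 7)%N ->
    ev2 (D 2%N) (e (inord k)) (e (inord l)) =
    (k == 5)%:R * (l == 6)%:R - (l == 5)%:R * (k == 6)%:R +
    e3 * ((k == 1)%:R * (l == 4)%:R - (l == 1)%:R * (k == 4)%:R).
  move=> kb lb; have k7 : (k < 7)%N by case/orP: kb => [/eqP ->|/andP[]].
  have l7 : (l < 7)%N by case/orP: lb => [/eqP ->|/andP[]].
  have Z i j : (j == 0%N) || (j == 2%N) -> (i == 1%N) || (2 < i < 7)%N -> (i < 7)%N ->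
      ev1 (w (inord j) y) (e (inord i)) = 0.
    move=> /orP[] /eqP -> ib i7; rewrite he' //.
      by case: i ib {i7} => [|i].
    by case: i ib {i7} => [|[|[|i]]].
  rewrite DE H3 ?Z // /ev_wedge !he' //.
  by rewrite ![_ == k]eq_sym ![_ == l]eq_sym.
split; last first.
  rewrite /orientation (E1 2 5)%N // (E1 1 3)%N // (E2 3 4)%N // (E2 2 6)%N //.
  by rewrite (E3 5 6)%N // (E3 1 4)%N //=; ring.
split.
- split=> f; rewrite !inE.
    by move=> /or4P [|||/or3P[]] /eqP ->; rewrite he'.
  by move=> /or4P [] /eqP ->; rewrite !he'.
- by rewrite !he'.
- rewrite (E1 2 3)%N // (E1 2 4)%N // (E1 2 6)%N // (E2 3 6)%N //=.
  by split; ring.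
- rewrite (E1 1 4)%N // (E1 1 5)%N // (E1 1 6)%N // (E3 5 4)%N //=.
  by split; ring.
- rewrite (E1 2 5)%N // (E1 1 3)%N // (E2 3 4)%N // (E3 5 6)%N //=.
  by rewrite !(mul0r, mulr0, mul1r, subr0, addr0, add0r) oner_neq0.
Qed.

End ContactInvariance.

(** This is the chain rule for [phi \o psi], the identity near [phi x]; tangent vectors are rows, so
    the Jacobian of [psi] acts first, on the left. *)
Lemma jacobian_cancel {R : realType} n (W W' : set 'rV[R]_n)
    (phi psi : 'rV[R]_n -> 'rV[R]_n) (x v : 'rV[R]_n) :
  diffeo W W' phi psi -> W x ->
  v *m jacobian psi (phi x) *m jacobian phi x = v.
Proof.
move=> [[oW oW' sphi spsi] [WW' W'W K K']] Wx.
have W'y : W' (phi x) by exact: WW'.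
have dphi : differentiable phi (psi (phi x)).
  by rewrite K //; exact: smooth_differentiable sphi Wx.
have dpsi : differentiable psi (phi x) by exact: smooth_differentiable spsi W'y.
have dc : differentiable (phi \o psi) (phi x) by exact: differentiable_comp.
have E : 'D_v (phi \o psi) (phi x) = v.
  rewrite -[RHS](derive_id (phi x)); apply: near_eq_derive.
  near=> z; rewrite /= K' //; near: z; exact: open_nbhs_nbhs.
have C : 'D_v (phi \o psi) (phi x) = 'd phi (psi (phi x)) ('d psi (phi x) v).
  rewrite (deriveE v dc).
  exact: (congr1 (fun h : 'rV[R]_n -> 'rV[R]_n => h v) (diff_comp dpsi dphi)).
rewrite E K // in C.
by rewrite /jacobian !mul_rV_lin1 /= -C.
Unshelve. all: by end_near. Qed.

Lemma plucker_decomposable {R : realType} n (P : 'M[R]_n) (a b : 'rV[R]_n)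
    (ker : 'rV[R]_n -> Prop) X Y Z T :
  (forall X Y, ker X -> ker Y -> ev2 P X Y = ev_wedge a b X Y) ->
  ker X -> ker Y -> ker Z -> ker T -> plucker P X Y Z T = 0.
Proof. by move=> E *; rewrite /plucker !E // /ev_wedge; ring. Qed.

(** Modulo [I_F E'] the derivatives of the first three forms of [w'] reduce to 0, to the wedge of
    the fourth and fifth, and to the wedge of the sixth and seventh, so their pullbacks meet the
    conditions of [local_sign]. The frame dual to [w'], carried back by the differential of [psi],
    is a test frame of orientation [eps']. *)
Lemma contact_sign {R : realType} (E E' : equation R)
    (M1 M2 M1' M2' : set (one_form R 7)) (w w' : 'I_7 -> one_form R 7) (eps eps' : R) :
  structure_equations E M1 M2 w eps -> structure_equations E' M1' M2' w' eps' ->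
  contact_equivalent E E' -> eps = eps'.
Proof.
move=> hw hw' [W [W' [phi [psi [[x Wx] WS WS' hphi Ieq]]]]].
have H := structure_on_sub WS (structure_equations_on hw).
have H' := structure_on_sub WS' (structure_equations_on hw').
have [[_ epsE] [IE _ _ _] _ _ _] := hw.
have [[_ epsE'] [IE' _ _ _] _ _ _] := hw'.
have [[oW oW' sphi spsi] [WW' _ _ _]] := hphi.
pose t (i : nat) := pullback phi (w' (inord i)).
have I'w' i : (i < 3)%N -> I_F E' (w' (inord i)).
  rewrite IE' => i3; apply: generated_mem.
  by case: i i3 => [|[|[|]]] //= _; [left; left|left; right|right].
have Iw i : (i < 3)%N -> I_F E (w (inord i)).
  rewrite IE => i3; apply: generated_mem.
  by case: i i3 => [|[|[|]]] //= _; [left; left|left; right|right].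
have tcomb i : (i < 3)%N ->
    combination W (w (inord 0)) (w (inord 1)) (w (inord 2)) (t i).
  move=> i3; apply: (@generated_combination _ _ W (I_F E)).
    by move=> b; rewrite IE => /generated3_combination; exact: combination_sub.
  by rewrite -Ieq; apply: generated_mem; exists (w' (inord i)) => //; exact: I'w'.
have [A HA] := choice (fun i : 'I_3 => tcomb i (ltn_ord i)).
have tE y i X : ev1 (t i y) X = ev1 (w' (inord i) (phi y)) (X *m jacobian phi y).
  exact: ev1_pull.
have DE y i : W y -> ext_d (t i) y =
    jacobian phi y *m ext_d (w' (inord i)) (phi y) *m (jacobian phi y)^T.
  move=> Wy; apply: (ext_d_pullback oW sphi Wy).
  by have [[dw' _] _ _ _] := H' _ (WW' _ Wy); exact: dw'.
have [[_ [e he]] _ _ _] := H' _ (WW' _ Wx).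
pose f i := e (inord i) *m jacobian psi (phi x).
have fJ i : f i *m jacobian phi x = e (inord i) by exact: jacobian_cancel hphi Wx.
have [F O] := dual_test_frame H' (WW' _ Wx) he
  (fun k => erefl (ext_d (w' (inord k)) (phi x))).
have TE i : (i < 3)%N -> forall y, W y -> t i y =
    A (inord i) (inord 0) y *: w (inord 0) y + A (inord i) (inord 1) y *: w (inord 1) y
    + A (inord i) (inord 2) y *: w (inord 2) y.
  by move=> i3 y Wy; rewrite -(HA (inord i)).2 // inordK.
have [||||||||k k0] := @local_sign _ W x w 1 eps (t 0%N) (t 1%N) (t 2%N) A
  (f 1%N) (f 2%N) (f 3%N) (f 4%N) (f 5%N) (f 6%N) oW Wx H.
- by move=> i j y Wy; exact: (HA i).1.
- exact: TE.
- exact: TE.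
- exact: TE.
- move=> X [X1 X2 X3].
  suff Z i : (i < 3)%N -> ev1 (w (inord i) x) X = 0 by split; exact: Z.
  (* By [Ieq], [w (inord i)] lies in the module generated by the pullbacks of [I_F E'], so it
     vanishes where the three pulled back generators do. *)
  move=> i3; apply: (@generated_ev _ _ W (pullback phi @` I_F E')) => //.
    by rewrite Ieq; apply: generated_mem; exact: Iw.
  move=> _ [eta Ieta <-]; rewrite [LHS]ev1_pull.
  rewrite IE' in Ieta; apply: (generated_ev Ieta (WS' _ (WW' _ Wx))).
  by move=> b [[->|->]|->]; rewrite -tE.
- move=> y X Y Wy [X1 X2 X3] [Y1 Y2 Y3].
  have [_ H1 _ _] := H' _ (WW' _ Wy).
  rewrite !tE in X1 X2 X3 Y1 Y2 Y3.
  rewrite DE // ev2_pull H1 // (ev_wedge_kerl _ X2 Y2) (ev_wedge_kerl _ X3 Y3).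
  by rewrite addr0.
- move=> y X Y Z T Wy.
  have [_ H1 H2 H3] := H' _ (WW' _ Wy).
  pose ker X := [/\ ev1 (t 0%N y) X = 0, ev1 (t 1%N y) X = 0 & ev1 (t 2%N y) X = 0].
  move=> kX kY kZ kT; split.
    apply: (plucker_decomposable (ker := ker) (a := t 3%N y) (b := t 4%N y)) => //.
    move=> X' Y' [X1 X2 X3] [Y1 Y2 Y3].
    rewrite !tE in X1 X2 X3 Y1 Y2 Y3.
    rewrite DE // ev2_pull H2 // (ev_wedge_kerl _ X3 Y3) mulr0 addr0.
    by rewrite /ev_wedge !tE.
  apply: (plucker_decomposable (ker := ker) (a := t 5%N y) (b := t 6%N y)) => //.
  move=> X' Y' [X1 X2 X3] [Y1 Y2 Y3].
  rewrite !tE in X1 X2 X3 Y1 Y2 Y3.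
  rewrite DE // ev2_pull H3 // (ev_wedge_kerl _ X2 Y2) mulr0 addr0.
  by rewrite /ev_wedge !tE.
- by rewrite !DE //; apply: test_frame_pull; rewrite !fJ.
rewrite !DE // orientation_pull !fJ O !mul1r.
(* At this point [eps' = k * eps] with [0 < k], and both are 1 or -1. *)
by case: epsE epsE' => -> [] -> //; lra.
Qed.

(** * Contact forms on jet space and vectors tangent to the equation *)

Section JetSpace.
Context {R : realType}.
Implicit Types (u X Y : 'rV[R]_8) (F : 'rV[R]_8 -> R).

Definition vec8 (s : seq R) : 'rV[R]_8 := \row_i nth 0 s i.

Lemma vec8E s k : (k < 8)%N -> vec8 s 0 (inord k) = nth 0 s k.
Proof. by move=> k8; rewrite mxE inordK. Qed.

Lemma sum8 (f : 'I_8 -> R) :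
  \sum_i f i = f jx + f jy + f jz + f jp + f jq + f jr + f js + f jt.
Proof.
rewrite !big_ord_recr big_ord0 /= add0r.
by do ![congr (_ + _)]; congr f; apply: val_inj; rewrite /= inordK.
Qed.

Lemma det_mx3 (a b c d e f g h i : R) :
  \det (mx3 [:: [:: a; b; c]; [:: d; e; f]; [:: g; h; i]]) =
  a * (e * i - f * h) - b * (d * i - f * g) + c * (d * h - e * g).
Proof.
rewrite (expand_det_row _ 0) !big_ord_recl big_ord0 /cofactor.
rewrite !(expand_det_row _ 0) !big_ord_recl !big_ord0 /cofactor !det_mx11.
by rewrite !mxE /= /bump /= !(expr0, expr1, addn0, add0n) ?exprS; ring.
Qed.

Lemma gradient_coord n (x : 'rV[R]_n) k : gradient (fun y => y 0 k) x = delta_mx 0 k.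
Proof. by apply/rowP => i; rewrite !mxE partial_coord. Qed.

Lemma ext_d_cst n (c x : 'rV[R]_n) : ext_d (fun=> c) x = 0.
Proof. by apply/matrixP => i j; rewrite !mxE !partial_cst subrr. Qed.

Section ContactForm.
Variables k0 k1 k2 : 'I_8.

(** A common shape for the three contact forms: [k0] is the jet variable, [k1] and [k2] are its
    derivatives in [x] and [y]. *)
Definition contact_form : one_form R 8 :=
  fun u => delta_mx 0 k0 - u 0 k1 *: delta_mx 0 jx - u 0 k2 *: delta_mx 0 jy.

Lemma contact_formE : contact_form = fun u => delta_mx 0 k0 +
  (u 0 k1 *: - delta_mx 0 jx + u 0 k2 *: - delta_mx 0 jy).
Proof. by apply/funext => u; rewrite /contact_form !scalerN addrA. Qed.

Lemma differentiable_contact_form u : differentiable contact_form u.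
Proof.
rewrite contact_formE; apply: differentiableD; first exact: differentiable_cst.
by apply: differentiableD; apply: differentiableZl; exact: differentiable_coord.
Qed.

Lemma ev1_contact_form u X :
  ev1 (contact_form u) X = X 0 k0 - u 0 k1 * X 0 jx - u 0 k2 * X 0 jy.
Proof. by rewrite !ev1B !ev1Z !ev1_delta. Qed.

Lemma ev2_contact_form u X Y : ev2 (ext_d contact_form u) X Y =
  X 0 jx * Y 0 k1 - Y 0 jx * X 0 k1 + (X 0 jy * Y 0 k2 - Y 0 jy * X 0 k2).
Proof.
rewrite contact_formE.
have dZ k (c : 'rV[R]_8) : differentiable (fun v : 'rV[R]_8 => v 0 k *: c) u.
  by apply: differentiableZl; exact: differentiable_coord.
rewrite ext_dD; [|exact: differentiable_cst|by apply: differentiableD].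
rewrite (ext_dD (dZ k1 _) (dZ k2 _)) ext_d_cst.
rewrite !ext_d_scale; try exact: differentiable_coord;
  try exact: differentiable_cst.
rewrite !ext_d_cst !ev2D !ev2Z !ev2_0 !ev2_wedge !gradient_coord /ev_wedge.
by rewrite !ev1N !ev1_delta; ring.
Qed.

End ContactForm.

Lemma theta_zE : theta_z = contact_form jz jp jq. Proof. by []. Qed.
Lemma theta_pE : theta_p = contact_form jp jr js. Proof. by []. Qed.
Lemma theta_qE : theta_q = contact_form jq js jt. Proof. by []. Qed.

(** The image of [J] lies in the hyperplane killed by [G], and both have dimension [m]. This serves
    to lift vectors tangent to [F = 0] to the parameter space. *)
Lemma sub_kernel m (J : 'M[R]_(m, m.+1)) (G X : 'rV[R]_m.+1) :
  \rank J = m -> J *m G^T = 0 -> G != 0 -> ev1 G X = 0 -> exists f, f *m J = X.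
Proof.
move=> rJ JG G0 GX.
have sJ : (J <= kermx G^T)%MS by apply/sub_kermxP.
have rK : \rank (kermx G^T) = m by rewrite mxrank_ker mxrank_tr rank_rV G0 subn1.
have /mxrank_leqif_sup [_ /esym] := sJ.
rewrite rJ rK eqxx => KJ.
have : (X <= kermx G^T)%MS.
  apply/sub_kermxP; apply/matrixP => i j; rewrite !ord1 [RHS]mxE -GX.
  by rewrite /ev1 -[G *m X^T]trmxK trmx_mul trmxK [RHS]mxE.
by move=> /submx_trans /(_ KJ) /submxP [f ->]; exists f.
Qed.

End JetSpace.

(** * Characteristic forms and an explicit test frame *)

Section CharacteristicForms.
Context {R : realType}.
Implicit Types (u X Y : 'rV[R]_8) (g h : 'rV[R]_8 -> R).

Definition char_form2 g : one_form R 8 := fun u => theta_p u + g u *: theta_q u.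
Definition char_form3 h : one_form R 8 := fun u => h u *: theta_p u + theta_q u.

Lemma differentiable_theta_p u : differentiable theta_p u.
Proof. by rewrite theta_pE; exact: differentiable_contact_form. Qed.

Lemma differentiable_theta_q u : differentiable theta_q u.
Proof. by rewrite theta_qE; exact: differentiable_contact_form. Qed.

Lemma differentiable_char_form2 g u :
  differentiable g u -> differentiable (char_form2 g) u.
Proof.
move=> dg; exact: differentiableD (differentiable_theta_p u)
  (differentiable_scale dg (differentiable_theta_q u)).
Qed.

Lemma differentiable_char_form3 h u :
  differentiable h u -> differentiable (char_form3 h) u.
Proof.
move=> dh; exact: differentiableD
  (differentiable_scale dh (differentiable_theta_p u)) (differentiable_theta_q u).
Qed.

Lemma ev2_theta_z u X Y : ev2 (ext_d theta_z u) X Y =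
  X 0 jx * Y 0 jp - Y 0 jx * X 0 jp + (X 0 jy * Y 0 jq - Y 0 jy * X 0 jq).
Proof. exact: ev2_contact_form. Qed.

Lemma ev2_char_form2 g u X Y : differentiable g u ->
  ev2 (ext_d (char_form2 g) u) X Y =
  X 0 jx * Y 0 jr - Y 0 jx * X 0 jr + (X 0 jy * Y 0 js - Y 0 jy * X 0 js) +
  (g u * (X 0 jx * Y 0 js - Y 0 jx * X 0 js + (X 0 jy * Y 0 jt - Y 0 jy * X 0 jt)) +
   ev_wedge (gradient g u) (theta_q u) X Y).
Proof.
move=> dg; have dp := differentiable_theta_p u; have dq := differentiable_theta_q u.
rewrite (ext_dD dp (differentiable_scale dg dq)) (ext_d_scale dg dq).
rewrite !ev2D ev2Z ev2_wedge.
by congr (_ + (_ * _ + _)); exact: ev2_contact_form.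
Qed.

Lemma ev2_char_form3 h u X Y : differentiable h u ->
  ev2 (ext_d (char_form3 h) u) X Y =
  h u * (X 0 jx * Y 0 jr - Y 0 jx * X 0 jr + (X 0 jy * Y 0 js - Y 0 jy * X 0 js)) +
   ev_wedge (gradient h u) (theta_p u) X Y +
  (X 0 jx * Y 0 js - Y 0 jx * X 0 js + (X 0 jy * Y 0 jt - Y 0 jy * X 0 jt)).
Proof.
move=> dh; have dp := differentiable_theta_p u; have dq := differentiable_theta_q u.
rewrite (ext_dD (differentiable_scale dh dp) dq) (ext_d_scale dh dp).
rewrite !ev2D ev2Z ev2_wedge.
by congr (_ * _ + _ + _); exact: ev2_contact_form.
Qed.

Lemma linear_root (a b : R) : b != 0 -> exists c, a + c * b = 0.
Proof. by move=> b0; exists (- (a / b)); field. Qed.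

(** Here [G] stands for the gradient of [F] and [l] for [lambda_plus]. The vectors [f4] and [f6]
    lift the total derivatives [D_x + a D_y] and [b D_x + D_y]; the [p] and [q] components of [f2]
    and [f3] are chosen so that [char_form3] and [char_form2] kill them; [f5] and [f7] are tangent
    to the fibres over first jets. *)
Lemma char_test_frame g h u (G : 'rV[R]_8) (l : R) :
  differentiable g u -> differentiable h u -> 0 < l -> 0 < 1 - g u * h u ->
  G 0 jr = l * h u -> G 0 js = l * (1 + g u * h u) -> G 0 jt = l * g u ->
  let T1 := ext_d theta_z u in let T2 := ext_d (char_form2 g) u in
  let T3 := ext_d (char_form3 h) u in
  exists f2 f3 f4 f5 f6 f7,
  [/\ forall f, f \in [:: f2; f3; f4; f5; f6; f7] -> ev1 G f = 0,
      test_frame (theta_z u) (char_form2 g u) (char_form3 h u) T1 T2 T3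
        f2 f3 f4 f5 f6 f7
    & orientation T1 T2 T3 f2 f3 f4 f5 f6 f7 = (1 - g u * h u) ^+ 6 *
      ((g u ^+ 2 * partial jr g u - g u * partial js g u + partial jt g u) *
       (partial jr h u - h u * partial js h u + h u ^+ 2 * partial jt h u))].
Proof.
move=> dg dh l0 d0 Gr Gs Gt T1 T2 T3.
set a := g u in d0 Gr Gs Gt *; set b := h u in d0 Gr Gs Gt *.
set p := u 0 jp; set q := u 0 jq; set r := u 0 jr; set s := u 0 js; set t := u 0 jt.
have k0 : l * (1 - a * b) != 0 by rewrite mulf_neq0 // gt_eqF.
(* On the fibre direction [(- a, 1, - b)] the form [G] takes the value [l * (1 - a * b)], which is
   nonzero, so [c] can be chosen to make the vector tangent to the equation. *)
pose base (v : seq R) c := vec8 [:: v`_0; v`_1; v`_2; v`_3; v`_4; - a * c; c; - b * c].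
have evG v c : ev1 G (base v c) =
    (G 0 jx * v`_0 + G 0 jy * v`_1 + G 0 jz * v`_2 + G 0 jp * v`_3 + G 0 jq * v`_4)
    + c * (l * (1 - a * b)).
  by rewrite ev1E sum8 !vec8E //= Gr Gs Gt; ring.
have lift v : exists c, ev1 G (base v c) = 0.
  have [c hc] := linear_root (G 0 jx * v`_0 + G 0 jy * v`_1 + G 0 jz * v`_2
    + G 0 jp * v`_3 + G 0 jq * v`_4) k0.
  by exists c; rewrite evG.
have [c2 G2] := lift [:: 0; 0; 0; 1; - b].
have [c3 G3] := lift [:: 0; 0; 0; - a; 1].
have [c4 G4] := lift [:: 1; a; p + a * q; r + a * s; s + a * t].
have [c6 G6] := lift [:: b; 1; b * p + q; b * r + s; b * s + t].
(* The fibre components of [f5] and [f7] are the squares of [(1, - b)] and [(- a, 1)], the null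
   covectors of the symbol of [F]. *)
pose f5 := vec8 [:: 0; 0; 0; 0; 0; 1; - b; b ^+ 2].
pose f7 := vec8 [:: 0; 0; 0; 0; 0; a ^+ 2; - a; 1].
have G5 : ev1 G f5 = 0 by rewrite ev1E sum8 !vec8E //= Gr Gs Gt; ring.
have G7 : ev1 G f7 = 0 by rewrite ev1E sum8 !vec8E //= Gr Gs Gt; ring.
exists (base [:: 0; 0; 0; 1; - b] c2), (base [:: 0; 0; 0; - a; 1] c3),
  (base [:: 1; a; p + a * q; r + a * s; s + a * t] c4), f5,
  (base [:: b; 1; b * p + q; b * r + s; b * s + t] c6), f7.
set f2 := base _ c2; set f3 := base _ c3; set f4 := base _ c4; set f6 := base _ c6.
have E1 X Y : ev2 T1 X Y =
  X 0 jx * Y 0 jp - Y 0 jx * X 0 jp + (X 0 jy * Y 0 jq - Y 0 jy * X 0 jq).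
  exact: ev2_theta_z.
have E2 X Y := ev2_char_form2 X Y dg; have E3 X Y := ev2_char_form3 X Y dh.
rewrite -/T2 -/a in E2; rewrite -/T3 -/b in E3.
have P X : ev1 (theta_p u) X = X 0 jp - r * X 0 jx - s * X 0 jy.
  exact: ev1_contact_form.
have Q X : ev1 (theta_q u) X = X 0 jq - s * X 0 jx - t * X 0 jy.
  exact: ev1_contact_form.
have Z X : ev1 (theta_z u) X = X 0 jz - p * X 0 jx - q * X 0 jy.
  exact: ev1_contact_form.
have C2 X : ev1 (char_form2 g u) X = ev1 (theta_p u) X + a * ev1 (theta_q u) X.
  by rewrite ev1D ev1Z.
have C3 X : ev1 (char_form3 h u) X = b * ev1 (theta_p u) X + ev1 (theta_q u) X.
  by rewrite ev1D ev1Z.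
have ev7 (H : 'rV[R]_8) : ev1 H f7 = a ^+ 2 * H 0 jr - a * H 0 js + H 0 jt.
  by rewrite ev1E sum8 !vec8E //=; ring.
have ev5 (H : 'rV[R]_8) : ev1 H f5 = H 0 jr - b * H 0 js + b ^+ 2 * H 0 jt.
  by rewrite ev1E sum8 !vec8E //=; ring.
have gradE (f : 'rV[R]_8 -> R) i : gradient f u 0 i = partial i f u by rewrite mxE.
have dgf7 := ev7 (gradient g u); have dhf5 := ev5 (gradient h u).
rewrite !gradE in dgf7 dhf5.
have V36 : ev2 T1 f3 f6 = - (1 - a * b) by rewrite E1 !vec8E //=; ring.
have V24 : ev2 T1 f2 f4 = - (1 - a * b) by rewrite E1 !vec8E //=; ring.
have V45 : ev2 T2 f4 f5 = (1 - a * b) ^+ 2.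
  by rewrite E2 /ev_wedge !Q !vec8E //=; ring.
have V67 : ev2 T3 f6 f7 = (1 - a * b) ^+ 2.
  by rewrite E3 /ev_wedge !P !vec8E //=; ring.
(* As [f3] and [f7] have no [x] and [y] components, only [dg /\ theta_q] contributes; [theta_q] is 1
   on [f3] and 0 on [f7]. *)
have V37 : ev2 T2 f3 f7 = - ev1 (gradient g u) f7.
  by rewrite E2 /ev_wedge !Q !vec8E //=; ring.
have V25 : ev2 T3 f2 f5 = - ev1 (gradient h u) f5.
  by rewrite E3 /ev_wedge !P !vec8E //=; ring.
split.
- move=> f; rewrite !inE.
  by move=> /or4P [|||/or3P[]] /eqP ->.
- split.
  + split=> f; rewrite !inE.
      by move=> /or4P [|||/or3P[]] /eqP ->; rewrite Z !vec8E //=; ring.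
    by move=> /or4P [] /eqP ->; rewrite C2 C3 P Q !vec8E //=; split; ring.
  + by rewrite C2 C3 !P !Q !vec8E //=; split; ring.
  + rewrite !E1 E2 /ev_wedge !Q !vec8E //=; split; ring.
  + rewrite !E1 E3 /ev_wedge !P !vec8E //=; split; ring.
  + by rewrite V36 V24 V45 V67 oppr_eq0 expf_neq0 gt_eqF.
- rewrite -dgf7 -dhf5 /orientation V36 V24 V45 V67 V37 V25.
  by move: (ev1 (gradient g u) f7) (ev1 (gradient h u) f5) => m1 m2; ring.
Qed.

End CharacteristicForms.

(** Since [l - B / 2] is the positive square root of [- D], [l] is the larger root of
    [l ^+ 2 - B * l + A * C]. Hence the symbol [A X^2 + B X Y + C Y^2] factors as
    [l (h X + Y) (X + g Y)], and [1 - g * h] equals [2 (l - B / 2) / l]. *)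
Lemma larger_root {R : realType} (A B C : R) (D := A * C - 4^-1 * B ^+ 2)
    (l := B / 2 + Num.sqrt `|D|) (g := C / l) (h := A / l) :
  D < 0 -> 0 < l ->
  [/\ A = l * h, C = l * g, B = l * (1 + g * h) & 0 < 1 - g * h].
Proof.
move=> hyp l0; have ln : l != 0 by rewrite gt_eqF.
have sq : (l - B / 2) ^+ 2 = - D.
  rewrite /l addrC addKr sqr_sqrtr ?normr_ge0 // ltr0_norm //.
have sp : 0 < l - B / 2.
  by rewrite /l addrC addKr sqrtr_gt0 normr_gt0 ltr0_neq0.
have root : l ^+ 2 - B * l + A * C = 0.
  by move: sq; rewrite /D; lra.
split.
- by rewrite /h; field.
- by rewrite /g; field.
- apply: (mulfI ln); rewrite /g /h.
  have -> : l * (l * (1 + C / l * (A / l))) =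
    l ^+ 2 + A * C by field.
  by lra.
- have -> : 1 - g * h = (l - B / 2) * 2 / l.
    rewrite /g /h; apply: (mulfI (expf_neq0 2 ln)).
    have -> : l ^+ 2 * (1 - C / l * (A / l)) =
      l ^+ 2 - A * C by field.
    have -> : l ^+ 2 * ((l - B / 2) * 2 / l) =
      2 * l ^+ 2 - B * l by field.
    by lra.
  by rewrite divr_gt0 // mulr_gt0.
Qed.

(** * Differentiability of [lambda_plus] and of the roots of the symbol *)

Section LambdaPlus.
Context {R : realType}.
Variables (U : set 'rV[R]_8) (F : 'rV[R]_8 -> R) (u : 'rV[R]_8).
Hypotheses (sF : smooth U F) (Uu : U u).
Hypotheses (hyp : discr F u < 0) (l0 : 0 < lambda_plus F u).

Let dpF k : differentiable (partial k F) u.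
Proof. exact: smooth_differentiable (smooth_partial k sF) Uu. Qed.

Lemma differentiable_discr : differentiable (discr F) u.
Proof.
apply: differentiableB; first exact: differentiableM (dpF _) (dpF _).
have dX : differentiable (fun v => partial js F v ^+ 2) u.
  have -> : (fun v => partial js F v ^+ 2) = (fun v => partial js F v * partial js F v).
    by apply/funext => v; rewrite expr2.
  exact: differentiableM (dpF js) (dpF js).
have dc : differentiable (fun=> 4^-1 : R) u by exact: differentiable_cst.
exact: differentiableM dc dX.
Qed.

(** Near [u] the discriminant stays negative, so the absolute value under the root is [- discr F],
    and the square root is differentiable at positive numbers. *)
Lemma differentiable_lambda_plus : differentiable (lambda_plus F) u.
Proof.
have dd := differentiable_discr.
apply: differentiableD.
  have dc : differentiable (fun=> 2^-1 : R) u by exact: differentiable_cst.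
  exact: differentiableM (dpF js) dc.
have dN : differentiable (fun v => - discr F v) u by exact: differentiableN.
have dsq : differentiable (@Num.sqrt R) (- discr F u).
  apply/derivable1_diffP; apply: (@ex_derive _ _ _ _ _ _ _ (is_derive1_sqrt _)).
  by rewrite oppr_gt0.
apply: (near_eq_differentiable _ (differentiable_comp dN dsq)).
have : \near u, discr F u < 0.
  have /differentiable_continuous := dd; move=> /cvgr_lt; exact.
by apply: filterS => v dv; rewrite /= ltr0_norm.
Qed.

Let l := lambda_plus F u.
Let g := partial jt F u / l.
Let h := partial jr F u / l.

Lemma differentiable_char_root k :
  differentiable (fun v => partial k F v / lambda_plus F v) u.
Proof.
apply: differentiableM (dpF k) _.
by apply: differentiableV; [exact: differentiable_lambda_plus|rewrite gt_eqF].
Qed.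

Lemma lambda_plus_root : [/\ partial jr F u = l * h, partial jt F u = l * g,
  partial js F u = l * (1 + g * h) & 0 < 1 - g * h].
Proof. exact: larger_root hyp l0. Qed.

End LambdaPlus.

(** * Decomposability modulo the contact forms *)

Section Decomposable.
Context {R : realType}.
Implicit Types (u X Y : 'rV[R]_8) (g h : 'rV[R]_8 -> R).

Lemma contact_kernel u X : ev1 (theta_z u) X = 0 -> ev1 (theta_p u) X = 0 ->
  ev1 (theta_q u) X = 0 ->
  [/\ X 0 jz = u 0 jp * X 0 jx + u 0 jq * X 0 jy,
      X 0 jp = u 0 jr * X 0 jx + u 0 js * X 0 jy
    & X 0 jq = u 0 js * X 0 jx + u 0 jt * X 0 jy].
Proof.
rewrite theta_zE theta_pE theta_qE !ev1_contact_form => Z P Q.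
by split; lra.
Qed.

(** The passage from [theta_p], [theta_q] to the characteristic forms has determinant
    [1 - g * h]. *)
Lemma char_kernel g h u X : 1 - g u * h u != 0 ->
  ev1 (char_form2 g u) X = 0 -> ev1 (char_form3 h u) X = 0 ->
  ev1 (theta_p u) X = 0 /\ ev1 (theta_q u) X = 0.
Proof.
have -> : ev1 (char_form2 g u) X = ev1 (theta_p u) X + g u * ev1 (theta_q u) X.
  by rewrite ev1D ev1Z.
have -> : ev1 (char_form3 h u) X = h u * ev1 (theta_p u) X + ev1 (theta_q u) X.
  by rewrite ev1D ev1Z.
move: (ev1 (theta_p u) X) (ev1 (theta_q u) X) => P Q d0 E2 E3.
have cancel (v : R) : (1 - g u * h u) * v = 0 -> v = 0.
  by move=> /eqP; rewrite mulf_eq0 (negPf d0) => /eqP.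
split; apply: cancel.
- transitivity ((P + g u * Q) - g u * (h u * P + Q)); first by ring.
  by rewrite E2 E3 mulr0 subrr.
- transitivity ((h u * P + Q) - h u * (P + g u * Q)); first by ring.
  by rewrite E2 E3 mulr0 subrr.
Qed.

(* On the common kernel of the contact forms and of dF, the relation dF = 0
   reduces (dr + g ds) and (ds + g dt) to multiples of each other modulo dx, dy. *)
Lemma char_decomposable g h u (G : 'rV[R]_8) (l : R)
    (ker := fun X => [/\ ev1 G X = 0, ev1 (theta_z u) X = 0, ev1 (theta_p u) X = 0
                       & ev1 (theta_q u) X = 0]) :
  differentiable g u -> differentiable h u -> l != 0 ->
  G 0 jr = l * h u -> G 0 js = l * (1 + g u * h u) -> G 0 jt = l * g u ->
  (exists a b, forall X Y, ker X -> ker Y ->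
     ev2 (ext_d (char_form2 g) u) X Y = ev_wedge a b X Y) /\
  (exists a b, forall X Y, ker X -> ker Y ->
     ev2 (ext_d (char_form3 h) u) X Y = ev_wedge a b X Y).
Proof.
move=> dg dh l0 Gr Gs Gt.
pose d k : 'rV[R]_8 := delta_mx 0 k.
(* With [G] the gradient of [F], [a] and [b] are the total [x] and [y] derivatives of [F] without
   their third order terms, divided by [l]. *)
pose a := (G 0 jx + u 0 jp * G 0 jz + u 0 jr * G 0 jp + u 0 js * G 0 jq) / l.
pose b := (G 0 jy + u 0 jq * G 0 jz + u 0 js * G 0 jp + u 0 jt * G 0 jq) / l.
have rel X : ker X -> h u * X 0 jr + (1 + g u * h u) * X 0 js + g u * X 0 jt =
    - (a * X 0 jx + b * X 0 jy).
  move=> [GX Z P Q]; have [Zx Px Qx] := contact_kernel Z P Q.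
  rewrite ev1E sum8 Zx Px Qx Gr Gs Gt in GX.
  apply: (mulfI l0).
  transitivity (- (l * a * X 0 jx + l * b * X 0 jy)); last by ring.
  have -> : l * a = G 0 jx + u 0 jp * G 0 jz + u 0 jr * G 0 jp + u 0 js * G 0 jq.
    by rewrite /a mulrC divfK.
  have -> : l * b = G 0 jy + u 0 jq * G 0 jz + u 0 js * G 0 jp + u 0 jt * G 0 jq.
    by rewrite /b mulrC divfK.
  by lra.
split.
(* Substituting [ds + g dt = - h (dr + g ds) - a dx - b dy] into
   [dx /\ (dr + g ds) + dy /\ (ds + g dt)] gives this product. *)
- exists (d jx - h u *: d jy), (d jr + g u *: d js + a *: d jy) => X Y kX kY.
  have [_ _ _ QX] := kX; have [_ _ _ QY] := kY.
  rewrite ev2_char_form2 // (ev_wedge_kerr _ QX QY).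
  rewrite /ev_wedge !ev1B !ev1D !ev1Z !ev1_delta.
  have RX : X 0 js + g u * X 0 jt = - h u * (X 0 jr + g u * X 0 js)
      - (a * X 0 jx + b * X 0 jy) by have := rel _ kX; lra.
  have RY : Y 0 js + g u * Y 0 jt = - h u * (Y 0 jr + g u * Y 0 js)
      - (a * Y 0 jx + b * Y 0 jy) by have := rel _ kY; lra.
  transitivity (X 0 jx * (Y 0 jr + g u * Y 0 js) - Y 0 jx * (X 0 jr + g u * X 0 js)
    + X 0 jy * (Y 0 js + g u * Y 0 jt) - Y 0 jy * (X 0 js + g u * X 0 jt)).
    by ring.
  by rewrite RX RY; ring.
- exists (d jy - g u *: d jx), (h u *: d js + d jt + b *: d jx) => X Y kX kY.
  have [_ _ PX _] := kX; have [_ _ PY _] := kY.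
  rewrite ev2_char_form3 // (ev_wedge_kerr _ PX PY).
  rewrite /ev_wedge !ev1B !ev1D !ev1Z !ev1_delta.
  have RX : h u * X 0 jr + X 0 js = - g u * (h u * X 0 js + X 0 jt)
      - (a * X 0 jx + b * X 0 jy) by have := rel _ kX; lra.
  have RY : h u * Y 0 jr + Y 0 js = - g u * (h u * Y 0 js + Y 0 jt)
      - (a * Y 0 jx + b * Y 0 jy) by have := rel _ kY; lra.
  transitivity (X 0 jx * (h u * Y 0 jr + Y 0 js) - Y 0 jx * (h u * X 0 jr + X 0 js)
    + X 0 jy * (h u * Y 0 js + Y 0 jt) - Y 0 jy * (h u * X 0 js + X 0 jt)).
    by ring.
  by rewrite RX RY; ring.
Qed.

End Decomposable.

(** * Sums and multiples of combinations *)

Section Combinations.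
Context {R : realType} {n : nat}.
Implicit Types (U : set 'rV[R]_n) (eta : one_form R n).

Lemma combinationD U (a1 a2 a3 b c : one_form R n) :
  combination U a1 a2 a3 b -> combination U a1 a2 a3 c ->
  combination U a1 a2 a3 (fun x => b x + c x).
Proof.
move=> [p [dp pE]] [q [dq qE]]; exists (fun i y => p i y + q i y); split.
  by move=> i y Uy; exact: differentiableD (dp i y Uy) (dq i y Uy).
move=> y Uy; rewrite pE // qE // !scalerDl.
by rewrite addrACA [in LHS](addrACA (p (inord 0) y *: a1 y)).
Qed.

Lemma combinationZ U (a1 a2 a3 b : one_form R n) (f : 'rV[R]_n -> R) :
  (forall x, U x -> differentiable f x) -> combination U a1 a2 a3 b ->
  combination U a1 a2 a3 (fun x => f x *: b x).
Proof.
move=> df [p [dp pE]]; exists (fun i y => f y * p i y); split.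
  by move=> i y Uy; exact: differentiableM (df y Uy) (dp i y Uy).
by move=> y Uy; rewrite pE // !scalerDr !scalerA.
Qed.

End Combinations.

(** * Replacing the defining function by its opposite *)

Section Opposite.
Context {R : realType} {n : nat}.
Variables (U : set 'rV[R]_n) (F : 'rV[R]_n -> R).
Hypotheses (oU : open U) (sF : smooth U F).

Lemma foldr_partialN s x : U x ->
  foldr partial (fun u => - F u) s x = - foldr partial F s x.
Proof.
elim: s x => [//|i s IHs] x Ux /=.
transitivity (partial i (fun u => - foldr partial F s u) x).
  by apply: near_eq_partial; near=> y; apply: IHs; near: y; exact: open_nbhs_nbhs.
rewrite /partial deriveN //.
by apply: diff_derivable; exact: sF.
Unshelve. all: by end_near. Qed.

Lemma smoothN : smooth U (fun u => - F u).
Proof.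
move=> s x Ux; apply: (@near_eq_differentiable _ _ _ (fun u => - foldr partial F s u)).
  near=> y; symmetry; apply: foldr_partialN; near: y; exact: open_nbhs_nbhs.
by apply: differentiableN; exact: sF.
Unshelve. all: by end_near. Qed.

End Opposite.

Lemma discrN {R : realType} (U : set 'rV[R]_8) (F : 'rV[R]_8 -> R) u :
  open U -> smooth U F -> U u -> discr (fun u => - F u) u = discr F u.
Proof.
move=> oU sF Uu; have E k : partial k (fun u => - F u) u = - partial k F u.
  exact: (foldr_partialN oU sF [:: k] Uu).
by rewrite /discr !E mulrNN sqrrN.
Qed.

(** * The two determinants and the sign of their product *)

Lemma tilde_I1E {R : realType} (F g : 'rV[R]_8 -> R) u (a b l : R) :
  lambda_plus F u = l -> partial jr F u = l * b -> partial js F u = l * (1 + a * b) ->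
  partial jt F u = l * a -> g = (fun v => partial jt F v / lambda_plus F v) ->
  tilde_I1 F u =
    - l ^+ 2 * (a ^+ 2 * partial jr g u - a * partial js g u + partial jt g u).
Proof.
(* The cofactors of the last row are [- l ^+ 2] times [(a ^+ 2, - a, 1)], the fibre components of
   [f7] in the explicit test frame. *)
move=> El Er Es Et gE; rewrite /tilde_I1 -gE det_mx3.
move: (partial jr g u) (partial js g u) (partial jt g u) => gr gs gt.
by rewrite El Er Es Et; ring.
Qed.

Lemma tilde_I2E {R : realType} (F h : 'rV[R]_8 -> R) u (a b l : R) :
  lambda_plus F u = l -> partial jr F u = l * b -> partial js F u = l * (1 + a * b) ->
  partial jt F u = l * a -> h = (fun v => partial jr F v / lambda_plus F v) ->
  tilde_I2 F u =
    - l ^+ 2 * (partial jr h u - b * partial js h u + b ^+ 2 * partial jt h u).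
Proof.
(* Here the cofactors of the last row are [- l ^+ 2] times the fibre components [(1, - b, b ^+ 2)]
   of [f5]. *)
move=> El Er Es Et hE; rewrite /tilde_I2 -hE det_mx3.
move: (partial jr h u) (partial js h u) (partial jt h u) => hr hs ht.
by rewrite El Er Es Et; ring.
Qed.

(** The function [F] is left free so as to cover both [eqF E] and its opposite. The explicit test
    vectors are tangent to the equation and lift through [iF E]; [local_sign] applied to the
    pullbacks of [theta_z] and of the characteristic forms then compares their orientation with
    [eps]. *)
Lemma sign_formula {R : realType} (E : equation R) (M1 M2 : set (one_form R 7))
    (w : 'I_7 -> one_form R 7) (eps : R) (F : 'rV[R]_8 -> R) x0 :
  nondegenerate_parametrization E -> structure_equations E M1 M2 w eps ->
  smooth (jet_domain E) F -> (forall x, Sigma E x -> F (iF E x) = 0) ->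
  (forall x, Sigma E x -> discr F (iF E x) < 0) ->
  Sigma E x0 -> 0 <= partial js F (iF E x0) ->
  eps = Num.sg (tilde_I1 F (iF E x0) * tilde_I2 F (iF E x0)).
Proof.
move=> [[oD _] [oS siF] rk im _] hw sF F0 hyp Sx0 Fs0.
have [[_ epsE] [IE _ _ _] _ _ _] := hw.
have iD x : Sigma E x -> jet_domain E (iF E x).
  by move=> Sx; have [] : locus E (iF E x) by rewrite -im; exists x.
have diF x : Sigma E x -> differentiable (iF E) x by exact: smooth_differentiable.
have l0 : 0 < lambda_plus F (iF E x0).
  rewrite /lambda_plus ltr_wpDl ?divr_ge0 // sqrtr_gt0 normr_gt0 ltr0_neq0 //.
  exact: hyp.
(* The condition on [F_s] is given at [x0] alone; positivity of [lambda_plus] persists nearby by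
   continuity and determines the neighbourhood [U]. *)
have nP : \near x0, Sigma E x0 /\ 0 < lambda_plus F (iF E x0).
  have dl : differentiable (lambda_plus F \o iF E) x0.
    apply: differentiable_comp (diF _ Sx0) _.
    exact: (differentiable_lambda_plus sF (iD _ Sx0) (hyp _ Sx0)).
  have nl : \near x0, 0 < (lambda_plus F \o iF E) x0.
    by have /differentiable_continuous := dl; move=> /cvgr_gt; exact.
  have nS : \near x0, Sigma E x0 by exact: open_nbhs_nbhs.
  by near=> y; split; near: y.
have : nbhs x0 [set x | Sigma E x /\ 0 < lambda_plus F (iF E x)] by exact: nP.
rewrite nbhsE => -[U [oU Ux0] UP].
have US x : U x -> Sigma E x by move=> /UP [].
have Ul x : U x -> 0 < lambda_plus F (iF E x) by move=> /UP [].
pose g u := partial jt F u / lambda_plus F u.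
pose h u := partial jr F u / lambda_plus F u.
have dg x : U x -> differentiable g (iF E x).
  by move=> Ux; apply: (differentiable_char_root sF); [exact/iD/US|exact/hyp/US|exact: Ul].
have dh x : U x -> differentiable h (iF E x).
  by move=> Ux; apply: (differentiable_char_root sF); [exact/iD/US|exact/hyp/US|exact: Ul].
have root x : U x -> let u := iF E x in let l := lambda_plus F u in
    [/\ partial jr F u = l * h u, partial jt F u = l * g u,
        partial js F u = l * (1 + g u * h u) & 0 < 1 - g u * h u].
  by move=> Ux; exact: lambda_plus_root (hyp _ (US _ Ux)) (Ul _ Ux).
have GE u k : gradient F u 0 k = partial k F u by rewrite mxE.
have G0 x : Sigma E x -> gradient F (iF E x) != 0.
  move=> Sx; apply/eqP => G0; have := hyp x Sx.
  by rewrite /discr -!GE G0 !mxE mulr0 expr0n /= mulr0 subrr ltxx.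
(* [F] vanishes identically along [iF E], so by the chain rule its differential kills the image of
   the Jacobian. *)
have JG x : Sigma E x -> jacobian (iF E) x *m (gradient F (iF E x))^T = 0.
  move=> Sx; apply/matrixP => i j; rewrite [RHS]mxE mxE.
  have dF : differentiable F (iF E x) by exact: smooth_differentiable sF (iD _ Sx).
  transitivity (partial i (F \o iF E) x); last first.
    rewrite -[RHS](partial_cst 0 x i); apply: near_eq_partial.
    by near=> y; apply: F0; near: y; exact: open_nbhs_nbhs.
  by rewrite (partial_comp i (diF _ Sx) dF); apply: eq_bigr => k _;
    rewrite [X in _ * X]mxE ord1 GE.
have GX x X : Sigma E x -> ev1 (gradient F (iF E x)) (X *m jacobian (iF E) x) = 0.
  move=> Sx; rewrite -ev1_pull -[gradient _ _]trmxK -trmx_mul JG //.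
  by rewrite trmx0 /ev1 mul0mx mxE.
pose Theta i := nth theta_z [:: theta_z; char_form2 g; char_form3 h] i.
pose t i := pullback (iF E) (Theta i).
have dTheta i x : (i < 3)%N -> U x -> differentiable (Theta i) (iF E x).
  case: i => [|[|[|//]]] _ Ux.
  - by rewrite /Theta /= theta_zE; exact: differentiable_contact_form.
  - exact: differentiable_char_form2 (dg _ Ux).
  - exact: differentiable_char_form3 (dh _ Ux).
have DE x i : (i < 3)%N -> U x -> ext_d (t i) x =
    jacobian (iF E) x *m ext_d (Theta i) (iF E x) *m (jacobian (iF E) x)^T.
  by move=> i3 Ux; exact: ext_d_pullback oS siF (US _ Ux) (dTheta _ _ i3 Ux).
have tE x i X : ev1 (t i x) X = ev1 (Theta i (iF E x)) (X *m jacobian (iF E) x).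
  exact: ev1_pull.
have pcomb b : [set pullback (iF E) theta_z; pullback (iF E) theta_p;
     pullback (iF E) theta_q] b ->
    combination U (w (inord 0)) (w (inord 1)) (w (inord 2)) b.
  move=> Hb; apply: (combination_sub US); apply: generated3_combination.
  by rewrite -IE; exact: generated_mem.
have dcomp (f : 'rV[R]_8 -> R) : (forall x, U x -> differentiable f (iF E x)) ->
    forall x, U x -> differentiable (f \o iF E) x.
  by move=> df x Ux; apply: differentiable_comp (diF _ (US _ Ux)) (df _ Ux).
have tcomb i : (i < 3)%N ->
    combination U (w (inord 0)) (w (inord 1)) (w (inord 2)) (t i).
  case: i => [|[|[|//]]] _.
  - by apply: pcomb; left; left.
  - have -> : t 1%N = (fun x => pullback (iF E) theta_p x +
        (g \o iF E) x *: pullback (iF E) theta_q x).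
      by apply/funext => x; rewrite /t /pullback mulmxDl -scalemxAl.
    apply: combinationD; first by apply: pcomb; left; right.
    by apply: combinationZ (dcomp _ dg) _; apply: pcomb; right.
  - have -> : t 2%N = (fun x => (h \o iF E) x *: pullback (iF E) theta_p x +
        pullback (iF E) theta_q x).
      by apply/funext => x; rewrite /t /pullback mulmxDl -scalemxAl.
    apply: combinationD; last by apply: pcomb; right.
    by apply: combinationZ (dcomp _ dh) _; apply: pcomb; left; right.
have [A HA] := choice (fun i : 'I_3 => tcomb i (ltn_ord i)).
have TE i : (i < 3)%N -> forall y, U y -> t i y =
    A (inord i) (inord 0) y *: w (inord 0) y + A (inord i) (inord 1) y *: w (inord 1) y
    + A (inord i) (inord 2) y *: w (inord 2) y.
  by move=> i3 y Uy; rewrite -(HA (inord i)).2 // inordK.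
have kerE x X : U x -> ev1 (t 0%N x) X = 0 -> ev1 (t 1%N x) X = 0 ->
    ev1 (t 2%N x) X = 0 -> let Y := X *m jacobian (iF E) x in
    [/\ ev1 (gradient F (iF E x)) Y = 0, ev1 (theta_z (iF E x)) Y = 0,
        ev1 (theta_p (iF E x)) Y = 0 & ev1 (theta_q (iF E x)) Y = 0].
  move=> Ux; rewrite !tE => K1 K2 K3 Y; have [_ _ _ d0] := root x Ux.
  have [|P Q] := char_kernel _ K2 K3; first by rewrite gt_eqF.
  by split => //; exact: GX (US _ Ux).
have [Gr Gt Gs d0] := root x0 Ux0.
rewrite -GE in Gr; rewrite -GE in Gt; rewrite -GE in Gs.
have [F2 [F3 [F4 [F5 [F6 [F7 [FG FT FO]]]]]]] :=
  char_test_frame (dg _ Ux0) (dh _ Ux0) l0 d0 Gr Gs Gt.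
have lift X : ev1 (gradient F (iF E x0)) X = 0 -> exists f, f *m jacobian (iF E) x0 = X.
  exact: sub_kernel (rk _ Sx0) (JG _ Sx0) (G0 _ Sx0).
have [f2 f2E] := lift _ (FG F2 (mem_head _ _)).
have [f3 f3E] : exists f, f *m jacobian (iF E) x0 = F3.
  by apply/lift/FG; rewrite !inE eqxx ?orbT.
have [f4 f4E] : exists f, f *m jacobian (iF E) x0 = F4.
  by apply/lift/FG; rewrite !inE eqxx ?orbT.
have [f5 f5E] : exists f, f *m jacobian (iF E) x0 = F5.
  by apply/lift/FG; rewrite !inE eqxx ?orbT.
have [f6 f6E] : exists f, f *m jacobian (iF E) x0 = F6.
  by apply/lift/FG; rewrite !inE eqxx ?orbT.
have [f7 f7E] : exists f, f *m jacobian (iF E) x0 = F7.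
  by apply/lift/FG; rewrite !inE eqxx ?orbT.
have H := structure_on_sub US (structure_equations_on hw).
have [||||||||k k0] := @local_sign _ U x0 w 1 eps (t 0%N) (t 1%N) (t 2%N) A
  f2 f3 f4 f5 f6 f7 oU Ux0 H.
- by move=> i j y Uy; exact: (HA i).1.
- exact: TE.
- exact: TE.
- exact: TE.
- move=> X [K1 K2 K3]; have [_ Z P Q] := kerE _ _ Ux0 K1 K2 K3.
  suff W i : (i < 3)%N -> ev1 (w (inord i) x0) X = 0 by split; exact: W.
  move=> i3.
  have : I_F E (w (inord i)).
    rewrite IE; apply: generated_mem.
    by case: i i3 => [|[|[|]]] //= _; [left; left|left; right|right].
  move/generated_ev; apply => //.
  by move=> b [[->|->]|->]; rewrite [LHS]ev1_pull.
- move=> y X Y Uy [X1 X2 X3] [Y1 Y2 Y3].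
  have [_ ZX PX QX] := kerE _ _ Uy X1 X2 X3; have [_ ZY PY QY] := kerE _ _ Uy Y1 Y2 Y3.
  have [_ EPX EQX] := contact_kernel ZX PX QX.
  have [_ EPY EQY] := contact_kernel ZY PY QY.
  (* On the contact kernel [dx /\ dp + dy /\ dq] vanishes because the second derivatives form a
     symmetric matrix. *)
  by rewrite DE // ev2_pull ev2_theta_z EPX EQX EPY EQY; ring.
- move=> y X Y Z T Uy.
  pose ker X := [/\ ev1 (t 0%N y) X = 0, ev1 (t 1%N y) X = 0 & ev1 (t 2%N y) X = 0].
  have [Gry Gty Gsy _] := root y Uy; rewrite -GE in Gry; rewrite -GE in Gty; rewrite -GE in Gsy.
  have ln : lambda_plus F (iF E y) != 0 by rewrite gt_eqF // Ul.
  have [[a2 [b2 E2]] [a3 [b3 E3]]] :=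
    char_decomposable (dg _ Uy) (dh _ Uy) ln Gry Gsy Gty.
  move=> kX kY kZ kT; split.
    apply: (plucker_decomposable (ker := ker) (a := a2 *m (jacobian (iF E) y)^T)
      (b := b2 *m (jacobian (iF E) y)^T)) => //.
    move=> X' Y' [X1 X2 X3] [Y1 Y2 Y3].
    rewrite DE // ev2_pull E2; [|exact: kerE|exact: kerE].
    by rewrite /ev_wedge !ev1_pull.
  apply: (plucker_decomposable (ker := ker) (a := a3 *m (jacobian (iF E) y)^T)
    (b := b3 *m (jacobian (iF E) y)^T)) => //.
  move=> X' Y' [X1 X2 X3] [Y1 Y2 Y3].
  rewrite DE // ev2_pull E3; [|exact: kerE|exact: kerE].
  by rewrite /ev_wedge !ev1_pull.
- rewrite !DE //; apply: test_frame_pull.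
  by rewrite f2E f3E f4E f5E f6E f7E.
rewrite !DE // orientation_pull f2E f3E f4E f5E f6E f7E FO mul1r.
rewrite GE in Gr; rewrite GE in Gs; rewrite GE in Gt.
rewrite (tilde_I1E erefl Gr Gs Gt (erefl g)) (tilde_I2E erefl Gr Gs Gt (erefl h)).
(* With [d = 1 - g * h] and [l = lambda_plus], the product of the two determinants is [eps] times
   the positive number [l ^+ 4 / d ^+ 6 * k]. *)
have alg (d l m1 m2 c e : R) : d != 0 -> d ^+ 6 * (m1 * m2) = c * e ->
    - l ^+ 2 * m1 * (- l ^+ 2 * m2) = (l ^+ 4 / d ^+ 6 * c) * e.
  by move=> dn O; rewrite -[RHS]mulrA -O; field.
move=> /(alg _ (lambda_plus F (iF E x0))) ->; last by rewrite gt_eqF.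
rewrite sgrM gtr0_sg ?mul1r; last by rewrite mulr_gt0 // divr_gt0 // exprn_gt0.
by case: epsE => ->; rewrite ?sgrN sgr1.
Unshelve. all: by end_near. Qed.

Theorem corollary3p4 (R : realType) (E : equation R)
    (M1 M2 : set (one_form R 7)) (w : 'I_7 -> one_form R 7) (eps : R)
    (hE : generic_hyperbolic E M1 M2)
    (hw : structure_equations E M1 M2 w eps) :
  (forall (E' : equation R) (M1' M2' : set (one_form R 7))
          (w' : 'I_7 -> one_form R 7) (eps' : R),
     generic_hyperbolic E' M1' M2' ->
     structure_equations E' M1' M2' w' eps' ->
     contact_equivalent E E' -> eps = eps') /\
  (forall F : 'rV[R]_8 -> R, F = eqF E \/ F = (fun u => - eqF E u) ->
     forall x, Sigma E x -> 0 <= partial js F (iF E x) ->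
       eps = Num.sg (tilde_I1 F (iF E x) * tilde_I2 F (iF E x))).
Proof.
have [nd hyp _ _ _] := hE; split.
  by move=> E' M1' M2' w' eps' _ hw' eqE; exact: contact_sign hw hw' eqE.
have [[oD sF] _ _ im _] := nd.
have L y : Sigma E y -> jet_domain E (iF E y) /\ eqF E (iF E y) = 0.
  by move=> Sy; have : locus E (iF E y) by rewrite -im; exists y.
move=> F [->|->] x Sx Fs.
  by apply: (sign_formula nd hw sF) => // y /L [].
apply: (sign_formula nd hw (smoothN oD sF)) => // y Sy; have [Dy Fy] := L y Sy.
  by rewrite Fy oppr0.
(* The discriminant is quadratic in the first derivatives, so hyperbolicity survives the change of
   sign. *)
by rewrite (discrN oD sF Dy); exact: hyp.
Qed.
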